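(* Let $\mathcal{S}\subset L^\Phi(\Omega,\mathcal{F},\mathbb{P})$ be a nonempty convex set of probability densities that is closed in $L^1$, and suppose that the functional $\rho(\eta)=\sup_{h\in\mathcal{S}}\mathbb{E}[\eta h]$ on $L^\Psi$ is rearrangement invariant. Suppose moreover that $$\lim_{\lambda\to\infty}\ \sup_{h\in\mathcal{S}}\ \lambda\,\mathbb{E}\left[\Phi\left(\frac{h}{\lambda}\right)\right]=0.$$ Let $\xi\in L^\Psi$ have distribution $\mu$, and let $\xi_n\colon(\Omega,\mathcal{F},\mathbb{P})\to\mathbb{R}$, $n\ge 1$, be an i.i.d. sequence of random variables with the same distribution $\mu$ as $\xi$. For each $N\ge 1$ define the (random) sample distribution $$\mu_N=\frac1N\sum_{n=1}^N\delta_{\xi_n},$$ where $\delta_y$ denotes the Dirac measure concentrated at $y$. Then almost surely $\rho(\mu_N)\to\rho(\mu)$ as $N\to\infty$.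
   Context: $(\Omega,\mathcal{F},\mathbb{P})$ is an atomless probability space. A probability density is an $h\in L^1$ with $h\ge 0$ a.s. and $\mathbb{E}[h]=1$. Young functions: $\Phi$ is an even real-valued function on $\mathbb{R}$ with $\Phi(x)=\int_0^{|x|}\phi(u)\,du$, where $\phi\colon\mathbb{R}_+\to\mathbb{R}_+$ is nondecreasing, continuous at $0$, $\phi(x)=0$ if and only if $x=0$, and $\lim_{x\to+\infty}\phi(x)=+\infty$. The conjugate Young function is $\Psi(x)=\int_0^{|x|}\psi(u)\,du$, where $\psi(x)=\inf\{u\mid\phi(u)>x\}$ for $x\ge 0$. Orlicz spaces: for $\Theta\in\{\Phi,\Psi\}$, $L^\Theta=\{\xi\mid \text{there is } k>0 \text{ with } \mathbb{E}[\Theta(k\xi)]<\infty\}$. When $\mathcal{S}\subset L^\Phi$ is a convex $L^1$-closed set of probability densities, the functional $\rho(\eta)=\sup_{h\in\mathcal{S}}\mathbb{E}[\eta h]$ is finite for every $\eta\in L^\Psi$. The functional $\rho$ is rearrangement invariant if $\rho(\eta)=\rho(\eta')$ whenever $\eta,\eta'$ have the same distribution. For a rearrangement invariant $\rho$ and a probability measure $\mu$ on $\mathbb{R}$ that is the distribution of an element $\eta\in L^\Psi$, write $\rho(\mu)=\rho(\eta)$. *)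

(* Defs.v *)
From HB Require Import structures.
From mathcomp Require Import all_boot all_order all_algebra finmap.
From mathcomp Require Import all_classical all_reals all_analysis.

Set Implicit Arguments.
Unset Strict Implicit.
Unset Printing Implicit Defensive.

Import Order.TTheory GRing.Theory Num.Theory.
Import numFieldNormedType.Exports.

Local Open Scope classical_set_scope.
Local Open Scope ring_scope.

(* Only the values of [phi] on [0, +oo[ matter. *)
Definition young_density (R : realType) (phi : R -> R) : Prop :=
  [/\ forall x, 0 <= x -> 0 <= phi x,
      forall x y, 0 <= x -> x <= y -> phi x <= phi y,
      phi x @[x --> 0^'+] --> phi 0,
      forall x, 0 <= x -> (phi x = 0 <-> x = 0) &
      phi x @[x --> +oo] --> +oo].

Definition young_fun (R : realType) (phi : R -> R) (x : R) : R :=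
  \int[lebesgue_measure]_(u in `[0, `|x|]) phi u.

(* The infimum is over a nonempty set when [phi] tends to +oo. *)
Definition conj_density (R : realType) (phi : R -> R) (x : R) : R :=
  inf [set u : R | 0 <= u /\ x < phi u].

Section functionals.
Context d (T : measurableType d) (R : realType) (P : probability T R).

Definition atomless : Prop :=
  forall A : set T, measurable A -> (0 < P A)%E ->
    exists B : set T, [/\ measurable B, B `<=` A, (0 < P B)%E & (P B < P A)%E].

Definition prob_density (h : {RV P >-> R}) : Prop :=
  [/\ (h : T -> R) \in Lfun P 1%E, {ae P, forall w, 0 <= h w} &
      ('E_P[h] = 1)%E].

Definition orlicz (Theta : R -> R) (X : {RV P >-> R}) : Prop :=
  exists2 k : R, 0 < k & ('E_P[(fun w => Theta (k * X w))%R] < +oo)%E.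

(* Elements of L^1 are represented by random variables. Constant sequences
   are allowed, so a closed set contains every version of each of its
   elements. *)
Definition L1_closed (S : set {RV P >-> R}) : Prop :=
  forall (h_ : nat -> {RV P >-> R}) (h : {RV P >-> R}),
    (forall n, S (h_ n)) -> (h : T -> R) \in Lfun P 1%E ->
    ('N[P]_1%E[EFin \o (h_ n \- h)%R] @[n --> \oo] --> 0)%E ->
    S h.

Definition sup_expectation (S : set {RV P >-> R}) (eta : {RV P >-> R}) : \bar R :=
  ereal_sup [set 'E_P[(eta \* h)%R]%E | h in S].

(* [P] is unspecified outside the measurable sets, so laws are compared on
   Borel sets only. *)
Definition has_law (X : {RV P >-> R}) (nu : set R -> \bar R) : Prop :=
  forall A : set R, measurable A -> distribution P X A = nu A.

Definition same_law (X Y : {RV P >-> R}) : Prop :=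
  has_law X (distribution P Y).

Definition rearrangement_invariant (D : set {RV P >-> R})
    (r : {RV P >-> R} -> \bar R) : Prop :=
  forall X Y : {RV P >-> R}, D X -> D Y -> same_law X Y -> r X = r Y.

(* The value of [r] at some element of [D] with law [nu]; independent of the
   choice when [r] is rearrangement invariant, and meaningful only when such
   an element exists. *)
Definition on_laws (D : set {RV P >-> R}) (r : {RV P >-> R} -> \bar R)
    (nu : set R -> \bar R) : \bar R :=
  r (xget (cst 0 : {mfun T >-> R}) [set X | D X /\ has_law X nu]).

Definition mutually_independent (X : nat -> {RV P >-> R}) : Prop :=
  forall (J : {fset nat}) (A : nat -> set R), (forall n, measurable (A n)) ->
    P (\bigcap_(n in [set` J]) (X n @^-1` A n)) =
    (\prod_(n <- J) P (X n @^-1` A n))%E.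

(* The sequence is indexed from 0: the N-th sample distribution uses
   X 0, ..., X N.-1. It is the zero measure for N = 0. *)
Definition sample_distribution (X : nat -> {RV P >-> R}) (w : T) (N : nat) :
    {measure set R -> \bar R} :=
  mscale (N%:R^-1)%:nng (msum (fun n => \d_(X n w)) N).

End functionals.

(* Main.v *)
Require Import Defs.
From HB Require Import structures.
From mathcomp Require Import all_boot all_order all_algebra finmap.
From mathcomp Require Import all_classical all_reals all_analysis.
From mathcomp Require Import measurable_realfun ring lra.

Set Implicit Arguments.
Unset Strict Implicit.
Unset Printing Implicit Defensive.

Import Order.TTheory GRing.Theory Num.Theory.
Import numFieldNormedType.Exports.

Local Open Scope classical_set_scope.
Local Open Scope ring_scope.

(** Let [Phi] and [Psi] be the conjugate Young functions and
    [rho eta = sup_h E (eta * h)] the support functional of [S].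

    Continuity of [rho]. Up to constants, Young's inequality gives
    [E |eta * h| <= l * E (Phi (h / l)) + l * E (Psi (k * eta))] for all
    positive [k] and [l]. By the hypothesis on [S], the first term is small
    uniformly over [S] once [l] is large; for this fixed [l] the second term is
    small as soon as [E (Psi (k * eta))] is ([uniform_modular_continuity]). Hence
    [rho eta_N] tends to [rho xi] whenever [E (Psi (k * (eta_N - xi)))] tends
    to 0 for some positive [k]. By rearrangement invariance it is enough to find,
    for almost every sample, variables [eta_N] on the given probability space
    whose laws are the sample distributions and for which this holds.

    Reduction to convergence in mean. Let [E (Psi (k * xi))] be finite, and let
    [G] be the odd nondecreasing function equal to [Psi (k * x)] for positive
    [x]. Superadditivity of [Psi] gives
    [Psi (k / 2 * (x - y)) <= |G x - G y|] ([young_fun_sub_le]), so it suffices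
    that [G eta_N] tends to [G xi] in mean, where [G xi] is integrable.

    The coupling. By Sierpinski's theorem ([atomless_exists_prob]) the space can
    be cut into [N] layers of probability [1/N] along which [xi] increases. The
    variable [eta_N] takes on these layers the sorted values of the sample
    ([exists_comonotone_sample]); it is comonotone with [xi]. Therefore the events
    [x < G eta_N] and [x < G xi] are nested, and the probability that [x]
    separates the two variables is the difference between the empirical and the
    true probability of [x < G y] ([comonotone_indic]).

    The laws of large numbers. On a fine finite grid these differences tend to 0
    by the strong law for indicators ([strong_law_bounded]). The mass beyond the
    range of the grid is a sample mean of the nonnegative integrable function
    [tail n (G y)], for which the upper bound by twice the expectation
    ([upper_law_integrable]) is enough, since that expectation tends to 0 when
    the grid grows. *)

(** * Young functions *)

Section young_functions.
Context {R : realType}.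
Implicit Type f : R -> R.

(** The part of [young_density] that the two conjugate densities share; as there,
    only the values on the half-line matter. *)
Definition nonneg_nondecreasing f :=
  (forall x, 0 <= x -> 0 <= f x) /\
  (forall x y, 0 <= x -> x <= y -> f x <= f y).

Local Notation mu := (@lebesgue_measure R).

Lemma nonneg_nondecreasing_integrable f a (i : interval R) :
  nonneg_nondecreasing f -> [set` i] `<=` `[0, a]%classic ->
  mu.-integrable [set` i] (EFin \o f).
Proof.
move=> [f0 fm] ia.
apply: measurable_bounded_integrable => //.
- apply: (@le_lt_trans _ _ (mu `[0, a]%classic)).
    by apply: le_measure; rewrite ?inE.
  by rewrite lebesgue_measure_itv/= lte_fin; case: ifPn; rewrite ?ltry.
- apply: (@eq_measurable_fun _ _ _ _ _ (fun u : R => f (Num.max 0 u))).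
    by move=> x; rewrite inE => /ia /=; rewrite in_itv/= => /andP[x0 _]; rewrite max_r.
  apply: nondecreasing_measurable => // x y xy; apply: fm.
    by rewrite le_max lexx.
  by rewrite ge_max le_max lexx/= le_max xy orbT.
- exists (`|f a|); split; first exact: num_real.
  move=> x ax y /ia/=; rewrite in_itv/= => /andP[y0 ya].
  rewrite (le_trans _ (ltW ax))// ger0_norm; last exact: f0.
  by rewrite (le_trans _ (ler_norm _))// fm.
Qed.

Lemma young_fun_ge0 f x : nonneg_nondecreasing f -> 0 <= young_fun f x.
Proof.
move=> [f0 _]; apply: Rintegral_ge0 => u /=; rewrite in_itv/= => /andP[u0 _].
exact: f0.
Qed.

Lemma young_fun_norm f x : young_fun f `|x| = young_fun f x.
Proof. by rewrite /young_fun normr_id. Qed.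

Lemma young_fun_leM f b : nonneg_nondecreasing f -> 0 <= b ->
  young_fun f b <= b * f b.
Proof.
move=> ff b0; rewrite /young_fun (ger0_norm b0).
rewrite (le_trans (y := \int[mu]_(u in `[0, b]) cst (f b) u))//.
  apply: le_Rintegral => //.
  - exact: (nonneg_nondecreasing_integrable (a := b) ff).
  - apply: (nonneg_nondecreasing_integrable (a := b)) => //.
    by split => *; rewrite /cst// ff.1.
  - by move=> u /=; rewrite in_itv/= => /andP[u0 ub]; rewrite ff.2.
rewrite Rintegral_cst//= lebesgue_measure_itv/= lte_fin mulrC.
case: ltgtP b0 => // [b0 _|<- _] /=; last by rewrite !mul0r.
by rewrite subr0.
Qed.

Lemma young_fun_ge_tangent f a c : nonneg_nondecreasing f -> 0 <= a -> a <= c ->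
  young_fun f a + (c - a) * f a <= young_fun f c.
Proof.
move=> ff a0 ac; have c0 := le_trans a0 ac.
rewrite addrC -lerBrDr /young_fun (ger0_norm a0) (ger0_norm c0).
rewrite (Rintegral_itvB (x := a)) ?bnd_simp//; last first.
  exact: (nonneg_nondecreasing_integrable (a := c) ff).
have sub : `]a, c]%classic `<=` `[0, c]%classic.
  move=> u /=; rewrite !in_itv/= => /andP[au ->].
  by rewrite (le_trans a0 (ltW au)).
rewrite (le_trans (y := \int[mu]_(u in `]a, c]) cst (f a) u))//.
  rewrite Rintegral_cst//= lebesgue_measure_itv/= lte_fin mulrC.
  by case: ltgtP ac => // <- _ /=; rewrite subrr.
apply: le_Rintegral => //.
- apply: (nonneg_nondecreasing_integrable (a := c)) => //.
  by split => *; rewrite /cst// ff.1.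
- exact: (nonneg_nondecreasing_integrable (a := c) ff).
- by move=> u /=; rewrite in_itv/= => /andP[au uc]; rewrite ff.2// ltW.
Qed.

(** Convex functions vanishing at the origin are superadditive; only the
    monotonicity of the density is used. *)
Lemma young_fun_superadditive f a b : nonneg_nondecreasing f ->
  0 <= a -> 0 <= b -> young_fun f a + young_fun f b <= young_fun f (a + b).
Proof.
move=> ff; wlog ba : a b / b <= a.
  move=> H a0 b0; have [ba|/ltW ab] := leP b a; first exact: H.
  by rewrite addrC (addrC a); exact: H.
move=> a0 b0; have ab : a <= a + b by rewrite lerDl.
apply: le_trans (young_fun_ge_tangent ff a0 ab).
rewrite lerD2l addrAC subrr add0r (le_trans (young_fun_leM ff b0))//.
by rewrite ler_wpM2l// ff.2.
Qed.

Lemma young_fun_le f a b : nonneg_nondecreasing f -> `|a| <= `|b| ->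
  young_fun f a <= young_fun f b.
Proof.
move=> ff ab; rewrite -(young_fun_norm f a) -(young_fun_norm f b).
apply: le_trans (young_fun_ge_tangent ff _ ab) => //.
by rewrite lerDl mulr_ge0 ?subr_ge0// ff.1.
Qed.

Lemma measurable_young_fun f : nonneg_nondecreasing f ->
  measurable_fun [set: R] (young_fun f).
Proof.
move=> ff.
apply: (@eq_measurable_fun _ _ _ _ _ (fun x : R => young_fun f (Num.max 0 `|x|))).
  by move=> x _; rewrite max_r// young_fun_norm.
apply: (measurableT_comp (f := fun x : R => young_fun f (Num.max 0 x))) => //.
apply: nondecreasing_measurable => // x y xy; apply: young_fun_le => //.
have max0 (z : R) : 0 <= Num.max 0 z by rewrite le_max lexx.
rewrite !ger0_norm ?max0//.
by rewrite ge_max max0/= le_max xy orbT.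
Qed.

Lemma young_density_nonneg_nondecreasing f :
  young_density f -> nonneg_nondecreasing f.
Proof. by case. Qed.

Lemma conj_density_nonempty f x : young_density f ->
  [set u : R | 0 <= u /\ x < f u] !=set0.
Proof.
move=> [_ _ _ _ /cvgryPgt/(_ x)[M [_ fM]]].
exists (Num.max 0 (M + 1)); split; first by rewrite le_max lexx.
by apply: fM; rewrite lt_max ltrDl ltr01 orbT.
Qed.

Lemma conj_density_has_lbound f x :
  has_lbound [set u : R | 0 <= u /\ x < f u].
Proof. by exists 0 => u []. Qed.

Lemma conj_density_nonneg_nondecreasing f : young_density f ->
  nonneg_nondecreasing (conj_density f).
Proof.
move=> ff; split => [x _|x y _ xy].
  by apply: lb_le_inf; [exact: conj_density_nonempty|move=> u []].
apply: lb_le_inf; first exact: conj_density_nonempty.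
move=> u [u0 yu]; apply: ge_inf; first exact: conj_density_has_lbound.
by split => //; exact: le_lt_trans yu.
Qed.

(** A form of Young's inequality that loses a factor 2 in the arguments. When
    b is at most f a, the product is at most the integral of f over [a, 2a];
    otherwise a is at most the generalised inverse of f at b, and the product
    is at most the integral of that inverse over [b, 2b]. *)
Lemma weak_young_inequality f a b : young_density f -> 0 <= a -> 0 <= b ->
  a * b <= young_fun f (2 * a) + young_fun (conj_density f) (2 * b).
Proof.
move=> yf a0 b0; have ff := young_density_nonneg_nondecreasing yf.
have fc := conj_density_nonneg_nondecreasing yf.
have twice (g : R -> R) (x : R) : nonneg_nondecreasing g -> 0 <= x ->
    x * g x <= young_fun g (2 * x).
  move=> gg x0; have xx : x <= 2 * x by rewrite ler_peMl// ler1n.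
  apply: le_trans (young_fun_ge_tangent gg x0 xx).
  rewrite (_ : 2 * x - x = x); last by ring.
  by rewrite lerDr young_fun_ge0.
have [bf|fb] := leP b (f a).
  rewrite -[leLHS]addr0 lerD ?young_fun_ge0//.
  by rewrite (le_trans _ (twice _ _ ff a0))// ler_wpM2l.
rewrite -[leLHS]add0r lerD ?young_fun_ge0//.
rewrite mulrC (le_trans _ (twice _ _ fc b0))// ler_wpM2l//.
apply: lb_le_inf; first exact: conj_density_nonempty.
move=> u [u0 bu]; rewrite leNgt; apply/negP => ua.
by have := lt_trans fb bu; rewrite ltNge ff.2// ltW.
Qed.

End young_functions.

(** * Atomless probability spaces *)

Section real_probability.
Context d (T : measurableType d) (R : realType) (P : probability T R).
Implicit Types (A B D : set T) (F : nat -> set T).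

(** The probability of a measurable set as a real number. *)
Definition prob A : R := fine (P A).

Lemma EFin_prob A : measurable A -> (prob A)%:E = P A.
Proof. by move=> mA; rewrite /prob fineK//; exact: fin_num_measure. Qed.

Lemma prob_ge0 A : 0 <= prob A.
Proof. by rewrite /prob fine_ge0. Qed.

Lemma prob_set0 : prob set0 = 0.
Proof. by rewrite /prob measure0. Qed.

Lemma prob_setT : prob setT = 1.
Proof. by rewrite /prob probability_setT. Qed.

Lemma le_prob A B : measurable A -> measurable B -> A `<=` B ->
  prob A <= prob B.
Proof.
by move=> mA mB AB; rewrite -lee_fin !EFin_prob// le_measure// inE.
Qed.

Lemma prob_setU A B : measurable A -> measurable B -> A `&` B = set0 ->
  prob (A `|` B) = prob A + prob B.
Proof.
move=> mA mB AB; apply: EFin_inj.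
rewrite EFinD !EFin_prob//; last exact: measurableU.
by rewrite measureU.
Qed.

Lemma prob_setD A B : measurable A -> measurable B -> B `<=` A ->
  prob (A `\` B) = prob A - prob B.
Proof.
move=> mA mB BA; apply/eqP; rewrite eq_sym subr_eq addrC eq_sym; apply/eqP.
rewrite -prob_setU ?setDIK ?setDUK//; exact: measurableD.
Qed.

Lemma prob_le1 A : measurable A -> prob A <= 1.
Proof. by move=> mA; rewrite -lee_fin EFin_prob// probability_le1. Qed.

Lemma prob_bigcup_le F c : (forall n, measurable (F n)) ->
  {homo F : m n / (m <= n)%N >-> m `<=` n} -> (forall n, prob (F n) <= c) ->
  prob (\bigcup_n F n) <= c.
Proof.
move=> mF ndF Fc; have mU : measurable (\bigcup_n F n) by exact: bigcup_measurable.
have cv : P (F n) @[n --> \oo] --> P (\bigcup_n F n).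
  by apply: nondecreasing_cvg_mu => // m n mn; apply/subsetPset; exact: ndF.
rewrite -lee_fin EFin_prob// -(cvg_lim _ cv)//.
apply: lime_le; first by apply/cvg_ex; exists (P (\bigcup_n F n)).
by apply: nearW => n; rewrite -EFin_prob// lee_fin.
Qed.

End real_probability.

Section sierpinski.
Context d (T : measurableType d) (R : realType) (P : probability T R).
Hypothesis P_atomless : atomless P.
Implicit Types A B C D : set T.

Lemma atomless_half A : measurable A -> 0 < prob P A ->
  exists B, [/\ measurable B, B `<=` A, 0 < prob P B & prob P B <= prob P A / 2].
Proof.
move=> mA; rewrite -lte_fin EFin_prob// => A0.
have [B [mB BA B0 BltA]] := P_atomless mA A0.
move: B0 BltA; rewrite -!EFin_prob// !lte_fin => B0 BltA.
have mAB : measurable (A `\` B) by exact: measurableD.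
have [h|h] := leP (prob P B) (prob P A / 2); first by exists B.
have AB : A `\` B `<=` A by move=> w [].
by exists (A `\` B); rewrite !prob_setD//; split => //; lra.
Qed.

(** Halving repeatedly yields parts of arbitrarily small positive probability. *)
Lemma atomless_small A (e : R) : measurable A -> 0 < prob P A -> 0 < e ->
  exists B, [/\ measurable B, B `<=` A, 0 < prob P B & prob P B < e].
Proof.
move=> mA A0 e0.
have H n : exists B, [/\ measurable B, B `<=` A, 0 < prob P B &
    prob P B <= prob P A / 2 ^+ n].
  elim: n => [|n [B [mB BA B0 Bn]]].
    by exists A; split => //; rewrite expr0 divr1.
  have [C [mC CB C0 hC]] := atomless_half mB B0.
  exists C; split => //; first exact: subset_trans BA.
  rewrite (le_trans hC)// exprSr invfM mulrA ler_pM2r ?invr_gt0//.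
pose n := Num.bound (e^-1).
have [B [mB BA B0 Bn]] := H n; exists B; split => //.
apply: le_lt_trans Bn _; rewrite ltr_pdivrMr ?exprn_gt0//.
apply: le_lt_trans (prob_le1 P mA) _.
rewrite -ltr_pdivrMl// mulr1 (lt_trans (archi_boundP _))//.
  by rewrite invr_ge0 ltW.
by rewrite -natrX ltr_nat ltn_expl.
Qed.

(** Sierpinski's theorem. The greedy sequence below gains at each step at least
    half of what is possible, so its union cannot be enlarged by any set of
    positive measure. *)
Theorem atomless_exists_prob A (t : R) : measurable A -> 0 <= t <= prob P A ->
  exists B, [/\ measurable B, B `<=` A & prob P B = t].
Proof.
move=> mA /andP[t0 tA].
pose ok B := [/\ measurable B, B `<=` A & prob P B <= t].
have step (B : set T) : exists B', ok B -> [/\ ok B', B `<=` B' &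
    forall C, ok C -> B `<=` C ->
      prob P C - prob P B <= 2 * (prob P B' - prob P B)].
  have [okB|] := pselect (ok B); last by exists B.
  pose E := [set prob P C | C in [set C | ok C /\ B `<=` C]].
  have EC C : ok C -> B `<=` C -> E (prob P C) by move=> okC BC; exists C.
  have E0 : E !=set0 by exists (prob P B); exact: EC.
  have Eub : has_ubound E by exists t => _ [C [[_ _ ?] _] <-].
  have BE : prob P B <= sup E by apply: ub_le_sup => //; exact: EC.
  have [sB|Bs] := leP (sup E) (prob P B).
    exists B => _; split => // C okC BC.
    rewrite subrr mulr0 subr_le0 (le_trans _ sB)//.
    by apply: ub_le_sup => //; exact: EC.
  have d0 : 0 < (sup E - prob P B) / 2 by rewrite divr_gt0// subr_gt0.
  have [_ [B' [okB' BB'] <-] hB'] := sup_adherent d0 (conj E0 Eub).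
  exists B' => _; split => // C okC BC.
  have : prob P C <= sup E by apply: ub_le_sup => //; exact: EC.
  lra.
have [next nextP] := choice step.
pose B_ := fix B_ n := if n is n'.+1 then next (B_ n') else set0.
have okB n : ok (B_ n).
  elim: n => [|n ih] /=; last by have [] := nextP _ ih.
  by split => //; rewrite prob_set0.
have mB n : measurable (B_ n) by have [] := okB n.
have ndB : {homo B_ : m n / (m <= n)%N >-> m `<=` n}.
  apply: homo_leq => [x //|y x z xy yz|n].
    exact: subset_trans yz.
  by have [] := nextP _ (okB n).
pose B := \bigcup_n B_ n.
have mU : measurable B by exact: bigcup_measurable.
have UA : B `<=` A by apply: bigcup_sub => n _; have [] := okB n.
have Ut : prob P B <= t by apply: prob_bigcup_le => // n; have [] := okB n.
exists B; split => //; apply/eqP; rewrite eq_le Ut/= leNgt; apply/negP => Blt.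
have mAB : measurable (A `\` B) by exact: measurableD.
have AB0 : 0 < prob P (A `\` B) by rewrite prob_setD//; lra.
have tB0 : 0 < t - prob P B by rewrite subr_gt0.
have [C [mC CAB C0 Ct]] := atomless_small mAB AB0 tB0.
have okBC : ok (B `|` C).
  split; [exact: measurableU| |].
    by rewrite subUset; split => // x /CAB[].
  rewrite prob_setU//; first by lra.
  by apply/seteqP; split => // x [Bx /CAB[_]].
have BC : prob P (B `|` C) = prob P B + prob P C.
  rewrite prob_setU//.
  by apply/seteqP; split => // x [Bx /CAB[_]].
(* At each step [C] was available, so the greedy choice gained at least half of
   its probability; this cannot go on for ever. *)
have grow n : n%:R * (prob P C / 2) <= prob P (B_ n).
  elim: n => [|n ih]; first by rewrite mul0r prob_ge0.
  have [_ _ /(_ (B `|` C) okBC)] := nextP _ (okB n).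
  have /[swap] /[apply] : B_ n `<=` B `|` C.
    by apply: subset_trans (@subsetUl _ _ _); exact: bigcup_sup.
  have : prob P (B_ n) <= prob P B by apply: le_prob => //; exact: bigcup_sup.
  rewrite BC => h1 h2.
  by rewrite -natr1 mulrDl mul1r /=; lra.
have C2 : 0 <= (prob P C / 2)^-1 by rewrite ltW// invr_gt0 divr_gt0.
have := archi_boundP C2.
set n := Num.bound _ => nbig.
have := le_trans (grow n) (prob_le1 P (mB n)).
rewrite leNgt -ltr_pdivrMr ?mul1r ?nbig//; lra.
Qed.

(** In every measurable set [D] there is a part of prescribed probability on
    which [X] is nowhere larger than on the remainder of [D]: all of
    [X < q] together with a part of [X = q], for a quantile [q]. *)
Lemma exists_lower_part (X : {RV P >-> R}) D (c : R) :
  measurable D -> 0 <= c <= prob P D ->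
  exists B, [/\ measurable B, B `<=` D, prob P B = c &
    forall b x, B b -> D x -> ~ B x -> X b <= X x].
Proof.
move=> mD /andP[c0 cD].
have [->|] := eqVneq c (prob P D); first by exists D; split => // b x _ Dx /(_ Dx).
rewrite eq_le cD/= -ltNge => {}cD.
have [->|] := eqVneq c 0; first by exists set0; split => //; rewrite prob_set0.
rewrite eq_le c0 andbT -ltNge => {}c0.
have mX (i : interval R) : measurable (X @^-1` [set` i]).
  by rewrite -[X in measurable X]setTI; exact: measurable_funPT.
pose L x := D `&` (X @^-1` `]-oo, x]).
pose U x := D `&` (X @^-1` `]x, +oo[).
have mL x : measurable (L x) by exact: measurableI.
have mU x : measurable (U x) by exact: measurableI.
have LU x : prob P (U x) = prob P D - prob P (L x).
  rewrite -prob_setD//; last exact: subIsetl.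
  congr prob; apply/seteqP; split => w; rewrite /U /L /= !in_itv/= andbT.
    by move=> [Dw xw]; split => // -[_]; rewrite leNgt xw.
  by move=> [Dw /not_andP[//|/negP]]; rewrite -ltNge.
have sL x y : x <= y -> L x `<=` L y.
  move=> xy w [Dw] /=; rewrite /L /= !in_itv/= => h; split => //.
  exact: le_trans xy.
have sU x y : y <= x -> U x `<=` U y.
  move=> xy w [Dw] /=; rewrite /U /= !in_itv/= !andbT => h; split => //.
  exact: le_lt_trans h.
pose E := [set x | c <= prob P (L x)].
have E0 : E !=set0.
  apply: contrapT => /set0P/negP; rewrite negbK => /eqP E0.
  have : prob P (\bigcup_n L n%:R) <= c.
    apply: prob_bigcup_le => // [m n mn|n]; first by apply: sL; rewrite ler_nat.
    by rewrite leNgt; apply/negP => /ltW h; have : E n%:R by []; rewrite E0.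
  rewrite (_ : \bigcup_n _ = D) ?leNgt ?cD//.
  apply/seteqP; split => [w [n _ []]//|w Dw].
  exists (Num.bound (X w)) => //; split => //=; rewrite in_itv/=.
  have [X0|/ltW X0] := leP 0 (X w); first by rewrite ltW// archi_boundP.
  by rewrite (le_trans X0).
have Elb : has_lbound E.
  apply: contrapT => nE.
  have : prob P (\bigcup_n U (- n%:R)) <= prob P D - c.
    apply: prob_bigcup_le => // [m n mn|n]; first by apply: sU; rewrite lerN2 ler_nat.
    rewrite LU lerB// leNgt; apply/negP => h; apply: nE; exists (- n%:R) => x Ex.
    rewrite leNgt; apply/negP => /ltW xn.
    by have := lt_le_trans h Ex; rewrite ltNge le_prob//; exact: sL.
  rewrite (_ : \bigcup_n _ = D); first by lra.
  apply/seteqP; split => [w [n _ []]//|w Dw].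
  exists (Num.bound (- X w)) => //; split => //=; rewrite in_itv/= andbT ltrNl.
  have [X0|X0] := leP 0 (- X w); first by rewrite archi_boundP.
  by rewrite (lt_le_trans X0).
(* [q] is a quantile: [D] meets [X < q] in probability at most [c], and meets
   [X <= q] in probability at least [c]. *)
pose q := inf E.
have qc : c <= prob P (L q).
  have : prob P (\bigcup_n U (q + n.+1%:R^-1)) <= prob P D - c.
    apply: prob_bigcup_le => // [m n mn|n].
      by apply: sU; rewrite lerD2l lef_pV2 ?posrE// ler_nat.
    rewrite LU lerB//.
    have n0 : 0 < n.+1%:R^-1 :> R by rewrite invr_gt0.
    have [x Ex xq] := inf_adherent n0 (conj E0 Elb).
    by apply: le_trans Ex _; apply: le_prob => //; apply/sL/ltW.
  rewrite (_ : \bigcup_n _ = U q); first by rewrite LU; lra.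
  apply/seteqP; split => [w [n _]|w]; rewrite /U /= !in_itv/= !andbT => -[Dw h].
    by split => //; apply: lt_trans h; rewrite ltrDl invr_gt0.
  have d0 : 0 < (X w - q) by rewrite subr_gt0.
  exists (Num.bound (X w - q)^-1) => //; split => //=; rewrite in_itv/= andbT -ltrBrDl.
  rewrite invf_plt ?posrE// (lt_trans (archi_boundP _)) ?ltr_nat//.
  by rewrite invr_ge0 ltW.
pose K := D `&` (X @^-1` `]-oo, q[).
pose Q := D `&` (X @^-1` [set q]).
have mK : measurable K by exact: measurableI.
have mQ : measurable Q.
  by rewrite /Q -set_itv1; exact: measurableI.
have Kc : prob P K <= c.
  have : prob P (\bigcup_n L (q - n.+1%:R^-1)) <= c.
    apply: prob_bigcup_le => // [m n mn|n].
      by apply: sL; rewrite lerD2l lerN2 lef_pV2 ?posrE// ler_nat.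
    rewrite leNgt; apply/negP => /ltW h.
    have : q <= q - n.+1%:R^-1 by apply: ge_inf.
    by rewrite leNgt ltrBlDr ltrDl invr_gt0 ltr0n.
  rewrite (_ : \bigcup_n _ = K)//.
  apply/seteqP; split => [w [n _]|w]; rewrite /L /K /= !in_itv/= => -[Dw h].
    by split => //; apply: le_lt_trans h _; rewrite ltrBlDr ltrDl invr_gt0.
  have d0 : 0 < (q - X w) by rewrite subr_gt0.
  exists (Num.bound (q - X w)^-1) => //; split => //=.
  rewrite in_itv/= lerBrDl -lerBrDr ltW//.
  rewrite invf_plt ?posrE// (lt_trans (archi_boundP _)) ?ltr_nat//.
  by rewrite invr_ge0 ltW.
have KQ0 : K `&` Q = set0.
  apply/seteqP; split => // w [[_ /=]]; rewrite in_itv/= => + [_ /= wq].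
  by rewrite wq ltxx.
have KQL : L q = K `|` Q.
  rewrite /L /K /Q -setIUr -preimage_setU; congr (_ `&` (_ @^-1` _)).
  by rewrite (@setUitv1 _ _ -oo%O q true).
have [|B [mB BQ Bc]] := @atomless_exists_prob Q (c - prob P K) mQ.
  by rewrite subr_ge0 Kc/= lerBlDl -prob_setU// -KQL.
exists (K `|` B); split.
- exact: measurableU.
- by rewrite subUset; split; [exact: subIsetl|move=> w /BQ[]].
- rewrite prob_setU// ?Bc; first by rewrite addrC subrK.
  by apply/seteqP; split => // w [Kw /BQ Qw]; rewrite -KQ0.
- move=> b x KBb Dx /not_orP[nK nB].
  have bq : X b <= q.
    by case: KBb => [[_ /=]|/BQ[_ /= ->//]]; rewrite in_itv/= => /ltW.
  apply: le_trans bq _; rewrite leNgt; apply/negP => h; by apply: nK; split.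
Qed.

End sierpinski.

(** * Realising a sample comonotonically with a random variable *)

Section comonotone_coupling.
Context d (T : measurableType d) (R : realType) (P : probability T R).
Implicit Types (U V : T -> R).

(** [U] and [V] are never ordered in opposite ways. The relation is required at
    all points rather than almost everywhere. *)
Definition comonotone U V := forall w w', U w < U w' -> V w <= V w'.

(** Iterating [exists_lower_part] cuts [T] into [N] layers of probability [1/N]
    along which [X] increases. *)
Lemma exists_lower_chain (P_atomless : atomless P) (X : {RV P >-> R}) (N : nat) :
  (0 < N)%N ->
  exists B : nat -> set T, [/\ forall i, measurable (B i),
    B 0%N = set0, B N = setT,
    {homo B : i j / (i <= j)%N >-> i `<=` j} &
    (forall i, (i <= N)%N -> prob P (B i) = i%:R / N%:R) /\
    (forall i w w', B i w -> ~ B i w' -> X w <= X w')].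
Proof.
move=> N0; have N0' : 0 < N%:R :> R by rewrite ltr0n.
pose ok (i : nat) (B : set T) := [/\ measurable B, prob P B = i%:R / N%:R &
  forall w w', B w -> ~ B w' -> X w <= X w'].
have step (iB : nat * set T) : exists B', (iB.1 < N)%N -> ok iB.1 iB.2 ->
    iB.2 `<=` B' /\ ok iB.1.+1 B'.
  case: iB => i B /=.
  have [iN|] := boolP (i < N)%N; last by exists B.
  have [[mB Bi lowB]|] := pselect (ok i B); last by exists B.
  have mCB : measurable (~` B) by exact: measurableC.
  have CB : prob P (~` B) = 1 - i%:R / N%:R.
    by rewrite -setTD prob_setD// prob_setT Bi.
  have Ni : (0 : R) <= N%:R^-1 <= prob P (~` B).
    apply/andP; split; first by rewrite invr_ge0 ltW.
    rewrite CB lerBrDr -{1}[N%:R^-1]mul1r -mulrDl.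
    by rewrite ler_pdivrMr// mul1r nat1r ler_nat.
  have [A [mA AB PA lowA]] := exists_lower_part P_atomless X mCB Ni.
  exists (B `|` A) => _ _; split; first exact: subsetUl.
  split; first exact: measurableU.
    rewrite prob_setU// ?Bi ?PA; first by rewrite -natr1 mulrDl mul1r.
    by apply/seteqP; split => // w [Bw /AB].
  move=> w w' [Bw|Aw] /not_orP[nB nA]; first exact: lowB.
  exact: lowA.
have [next nextP] := choice step.
pose B_ := fix B_ n := if n is n'.+1 then next (n', B_ n') else set0.
have okB n : (n <= N)%N -> ok n (B_ n).
  elim: n => [_|n ih nN] /=; first by split => //; rewrite prob_set0 mul0r.
  by have [] := nextP (n, B_ n) nN (ih (ltnW nN)).
have subB n : (n < N)%N -> B_ n `<=` B_ n.+1.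
  by move=> nN; have [] := nextP (n, B_ n) nN (okB _ (ltnW nN)).
(* [B_ N] has probability 1 but need not be everything; the last set of the
   chain is the whole space instead. *)
exists (fun i => if (i < N)%N then B_ i else setT); split => [i| | | |].
- by case: ifPn => // iN; have [] := okB _ (ltnW iN).
- by rewrite N0.
- by rewrite ltnn.
- apply: homo_leq => [x //|y x z xy yz|i]; first exact: subset_trans yz.
  case: ifPn => [iN|]; case: ifPn => // iN'; first exact: subB.
  by rewrite (ltn_trans (ltnSn i) iN').
- split => [i|i w w'].
    rewrite leq_eqVlt => /predU1P[->|iN].
      by rewrite ltnn prob_setT divff// gt_eqF.
    by rewrite iN; have [] := okB _ (ltnW iN).
  by case: ifPn => // iN; have [_ _] := okB _ (ltnW iN); exact.
Qed.

(** Every finite sample is the range of a random variable on [T] whose law is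
    the empirical distribution and which is ordered like a given random
    variable: put the sorted sample on the successive layers of a chain of
    lower parts. *)
Lemma exists_comonotone_sample (P_atomless : atomless P) (X : {RV P >-> R})
    (y : nat -> R) (N : nat) : (0 < N)%N ->
  exists eta : {RV P >-> R},
    [/\ exists M, forall w, `|eta w| <= M,
        forall A, measurable A -> distribution P eta A =
          ((N%:R^-1)%:E * \sum_(n < N) \d_(y n) A)%E &
        comonotone eta X].
Proof.
move=> N0; have [B [mB B0 BN ndB [PB lowB]]] := exists_lower_chain P_atomless X N0.
pose A i := B i.+1 `\` B i.
have mA i : measurable (A i) by exact: measurableD.
pose s := sort <=%R (mkseq y N).
have sN : size s = N by rewrite size_sort size_mkseq.
have s_sorted : sorted <=%R s by exact/sort_sorted/le_total.
have AP w : exists i : 'I_N, A i w.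
  have ex : exists n, `[< B n w >] by exists N; apply/asboolP; rewrite BN.
  have /asboolP := ex_minnP ex; case: ex_minnP => -[|i] /asboolP Bi hmin.
    by move: Bi; rewrite B0.
  have iN : (i < N)%N by apply: hmin; apply/asboolP; rewrite BN.
  move=> _; exists (Ordinal iN); split => //= Biw.
  by have := hmin i (introT (asboolP _) Biw); rewrite ltnn.
have Auniq w i j : A i w -> A j w -> i = j.
  move=> [Bi nBi] [Bj nBj]; apply/eqP; rewrite eqn_leq.
  apply/andP; split; rewrite leqNgt; apply/negP => ij.
  - by apply: nBi; exact: ndB Bj.
  - by apply: nBj; exact: ndB Bi.
pose eta w := \sum_(i < N) s`_i * \1_(A i) w.
have etaA (i : 'I_N) w : A i w -> eta w = s`_i.
  move=> Aiw; rewrite /eta (bigD1 i)//= big1 ?addr0 => [|j ji].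
    by rewrite indicE mem_set// mulr1.
  rewrite indicE memNset ?mulr0// => Ajw.
  by move/eqP: ji; apply; apply: val_inj; exact: Auniq Aiw.
have meta : measurable_fun [set: T] eta.
  by apply: measurable_sum => i; apply: measurable_funM.
pose mix := isMeasurableFun.Build _ _ _ _ eta meta.
pose eta' : {mfun T >-> R} := HB.pack eta mix.
exists eta'; split.
- exists (\sum_(i < N) `|s`_i|) => w; have [i Ai] := AP w.
  by rewrite /= (etaA i)// (bigD1 i)//= lerDl sumr_ge0.
- move=> C mC; rewrite /distribution /pushforward.
  have -> : eta' @^-1` C = \big[setU/set0]_(i < N) (A i `&` [set _ | C s`_i]).
    rewrite -(bigcup_mkord N (fun i => A i `&` [set _ | C s`_i])).
    apply/seteqP; split => w /=.
      move=> Cw; have [i Ai] := AP w; exists i => /=; first exact: ltn_ord.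
      by split => //=; rewrite -(etaA i w Ai).
    by move=> [i /= iN [Ai]] /= Cs; rewrite (etaA (Ordinal iN) w Ai).
  have mAC i : measurable (A i `&` [set _ | C s`_i]).
    apply: measurableI => //; have [h|h] := pselect (C s`_i).
      by rewrite (_ : [set _ | _] = setT)//; apply/seteqP; split.
    by rewrite (_ : [set _ | _] = set0)//; apply/seteqP; split.
  rewrite measure_bigsetU_ord//; last first.
    apply/trivIsetP => i j _ _ ij; apply/seteqP; split => // w [[Ai _] [Aj _]].
    by move/eqP: ij; apply; apply: val_inj; exact: Auniq Aj.
  have -> : (\sum_(n < N) \d_(y n) C = \sum_(i < N) \d_(s`_i) C :> \bar R)%E.
    transitivity (\sum_(x <- mkseq y N) (\d_x C : \bar R))%E.
      by rewrite big_map -[in RHS](subn0 N) big_mkord.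
    rewrite -(perm_big _ (permEl (perm_sort <=%R _)))/=.
    by rewrite (big_nth 0) -/s sN big_mkord.
  rewrite ge0_sume_distrr//; apply: eq_bigr => i _.
  have PAi : prob P (A i) = N%:R^-1.
    rewrite prob_setD ?PB ?(ltnW (ltn_ord i))//; last exact: ndB.
    by rewrite -natr1 mulrDl mul1r addrAC subrr add0r.
  rewrite diracE; have [h|h] := pselect (C s`_i).
    rewrite mem_set// mule1 -PAi EFin_prob//; congr (P _).
    by apply/seteqP; split => w // [].
  rewrite memNset// mule0 (_ : _ `&` _ = set0) ?measure0//.
  by apply/seteqP; split => w // [].
- move=> w w' /=; have [i Ai] := AP w; have [j Aj] := AP w'.
  rewrite (etaA i)// (etaA j)// => sij.
  have ij : (i < j)%N.
    rewrite ltnNge; apply/negP => ji.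
    have := sorted_leq_nth le_trans le_refl 0 s_sorted; move=> /(_ j i).
    by rewrite !inE sN !ltn_ord => /(_ erefl erefl ji); rewrite leNgt sij.
  by apply: (lowB j); [exact: (ndB _ _ ij _ Ai.1)|exact: Aj.2].
Qed.

(** For comonotone variables the sets [U > x] and [V > x] are nested. *)
Lemma comonotone_indic U V (x : R) :
  measurable_fun [set: T] U -> measurable_fun [set: T] V -> comonotone U V ->
  (\int[P]_w `|(x < U w)%R%:R - (x < V w)%R%:R : R|%:E =
   `|prob P [set w | x < U w] - prob P [set w | x < V w]|%:E)%E.
Proof.
move=> mU mV UV.
have m (f : T -> R) : measurable_fun [set: T] f -> measurable [set w | x < f w].
  move=> mf; rewrite -[X in measurable X]setTI.
  rewrite (_ : [set w | x < f w] = f @^-1` `]x, +oo[); first exact: mf.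
  by apply/seteqP; split => w /=; rewrite in_itv/= andbT.
have aux (f g : T -> R) : measurable_fun [set: T] f -> measurable_fun [set: T] g ->
    [set w | x < f w] `<=` [set w | x < g w] ->
    (\int[P]_w `|(x < f w)%R%:R - (x < g w)%R%:R : R|%:E =
   `|prob P [set w | x < f w] - prob P [set w | x < g w]|%:E)%E.
  move=> mf mg fg.
  have mD : measurable ([set w | x < g w] `\` [set w | x < f w]).
    by apply: measurableD; exact: m.
  rewrite distrC -prob_setD//; [|exact: m..].
  rewrite ger0_norm ?prob_ge0// EFin_prob//.
  rewrite -[X in P X]setIT -integral_indic//.
  apply: eq_integral => w _; rewrite indicE.
  have [fw|fw] := boolP (x < f w).
    by rewrite (fg w fw) subrr normr0 memNset//= => -[].
  have [gw|gw] := boolP (x < g w).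
    by rewrite sub0r normrN normr1 mem_set//; split => //; apply/negP.
  by rewrite subrr normr0 memNset// => -[/= gw']; rewrite gw' in gw.
have [|] := pselect ([set w | x < U w] `<=` [set w | x < V w]); first exact: aux.
move=> /existsNP[w0 /not_implyP[/= U0 /negP]]; rewrite -leNgt => V0.
rewrite distrC -aux//; first by apply: eq_integral => w _; rewrite distrC.
move=> w /= Vw; rewrite ltNge; apply/negP => Uw.
by have := UV w w0 (le_lt_trans Uw U0); rewrite leNgt (le_lt_trans V0 Vw).
Qed.

End comonotone_coupling.

(** * Moments of pairwise independent variables *)

Section summable_expectations.
Context d (T : measurableType d) (R : realType) (P : probability T R).

(** Nonnegative functions with summable integrals tend to 0 almost surely,
    since their series has a finite integral. *)
Lemma ae_cvg0_summable_integral (g : nat -> T -> R) (C : R) :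
  (forall k, measurable_fun [set: T] (g k)) -> (forall k w, 0 <= g k w) ->
  (forall K, \sum_(k < K) \int[P]_w (g k w)%:E <= C%:E)%E ->
  {ae P, forall w, g ^~ w @ \oo --> (0 : R)}.
Proof.
move=> mg g0 gC; pose G w := (\sum_(0 <= k <oo) (g k w)%:E)%E.
have mgE k : measurable_fun [set: T] (EFin \o g k) by exact/measurable_EFinP.
have gE0 k w : (0 <= (g k w)%:E)%E by rewrite lee_fin.
have mG : measurable_fun [set: T] G.
  have := @ge0_emeasurable_sum _ _ _ setT (fun k w => (g k w)%:E) predT.
  by apply => [k w _ _|k _]; [exact: gE0|exact: mgE].
have intG : P.-integrable setT G.
  apply/integrableP; split => //.
  under eq_integral do rewrite gee0_abs ?nneseries_ge0//.
  rewrite integral_nneseries// (@le_lt_trans _ _ C%:E) ?ltry//.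
  apply: lime_le; first by apply: is_cvg_nneseries => n _ _; exact: integral_ge0.
  by apply: nearW => K; rewrite big_mkord.
apply: filterS (integrable_ae measurableT intG) => w /(_ Logic.I) Gfin.
apply: cvg_series_cvg_0; apply: nondecreasing_is_cvgn.
  by apply/nondecreasing_seqP => n; rewrite seriesSr lerDl.
exists (fine (G w)) => _ [n _ <-].
by rewrite -lee_fin fineK// seriesEnat/= -sumEFin; exact: nneseries_lim_ge.
Qed.

End summable_expectations.

Section pairwise_independence.
Context d (T : measurableType d) (R : realType) (P : probability T R).
Implicit Types X : nat -> {RV P >-> R}.

(** Product rule for pairs of distinct indices, the only consequence of mutual
    independence that the laws of large numbers below need. *)
Definition pairwise_independent X := forall i j (A B : set R), i != j ->
  measurable A -> measurable B ->
  P (X i @^-1` A `&` X j @^-1` B) = (P (X i @^-1` A) * P (X j @^-1` B))%E.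

Lemma mutually_pairwise_independent X :
  mutually_independent X -> pairwise_independent X.
Proof.
move=> indep i j A B ij mA mB.
have mC n : measurable (if n == i then A else B) by case: ifP.
have := indep [fset i; j]%fset _ mC.
rewrite big_fsetU1 ?inE// big_seq_fset1 eqxx eq_sym (negbTE ij) => <-.
congr (P _); apply/seteqP; split => [w [Ai Bj] n /=|w h].
  by rewrite !inE => /orP[]/eqP->; rewrite ?eqxx// eq_sym (negbTE ij).
split; first by have := h i; rewrite /= !inE eqxx; exact.
by have := h j; rewrite /= !inE eqxx orbT eq_sym (negbTE ij); exact.
Qed.

End pairwise_independence.

Section iid_moments.
Context d (T : measurableType d) (R : realType) (P : probability T R).
Variables (X : nat -> {RV P >-> R}) (Y : {RV P >-> R}).
Hypothesis X_law : forall n, same_law (X n) Y.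
Hypothesis X_indep : pairwise_independent X.
Local Open Scope ereal_scope.

Lemma integral_same_law (U V : {RV P >-> R}) (f : R -> \bar R) :
  same_law U V -> measurable_fun [set: R] f -> (forall y, 0 <= f y) ->
  \int[P]_w f (U w) = \int[P]_w f (V w).
Proof.
move=> UV mf f0; rewrite -(ge0_integral_distribution U)//.
rewrite -(ge0_integral_distribution V)//.
by apply: eq_measure_integral => A mA _; exact: UV.
Qed.

Lemma integral_indep_mul i j (f : R -> \bar R) : i != j ->
  measurable_fun [set: R] f -> (forall y, 0 <= f y) ->
  \int[P]_w (f (X i w) * f (X j w)) =
  \int[P]_w f (Y w) * \int[P]_w f (Y w).
Proof.
move=> ij mf f0.
have mp : measurable_fun [set: T] (fun w => (X i w, X j w)).
  by apply: measurable_fun_pair; exact: measurable_funPT.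
pose h z := f z.1 * f z.2.
have mh : measurable_fun [set: R * R] h.
  by apply: emeasurable_funM; exact: measurableT_comp.
have h0 z : 0 <= h z by rewrite mule_ge0.
transitivity (\int[pushforward P (fun w => (X i w, X j w))]_z h z).
  by rewrite ge0_integral_pushforward.
(* By independence the joint law is the product of the marginal laws. *)
rewrite (eq_measure_integral
  (distribution P (X i) \x distribution P (X j))); last first.
  move=> A mA _; apply/esym.
  by apply: product_measure_unique => // B C mB mC; exact: X_indep.
rewrite fubini_tonelli1// /fubini_F.
transitivity (\int[distribution P (X i)]_x (f x * \int[P]_w f (Y w))).
  apply: eq_integral => x _; rewrite /h/= ge0_integralZl//.
  by congr (_ * _); rewrite ge0_integral_distribution//=; exact: integral_same_law.
rewrite ge0_integralZr//; last exact: integral_ge0.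
by congr (_ * _); rewrite ge0_integral_distribution//=; exact: integral_same_law.
Qed.

(** Chebyshev's computation of the variance of a sum of pairwise independent
    identically distributed variables. *)
Lemma variance_iid_sum (f : R -> R) (m v : R) n :
  measurable_fun [set: R] f -> (forall y, 0 <= f y)%R ->
  \int[P]_w (f (Y w))%:E = m%:E ->
  \int[P]_w ((f (Y w)) ^+ 2)%:E = v%:E ->
  \int[P]_w ((\sum_(i < n) f (X i w) - n%:R * m) ^+ 2)%:E <= (n%:R * v)%:E.
Proof.
move=> mf f0 fm fv.
have m0 : (0 <= m)%R by rewrite -lee_fin -fm integral_ge0// => w _; rewrite lee_fin.
pose S w : R := (\sum_(i < n) f (X i w))%R.
have mfX i : measurable_fun [set: T] (fun w => f (X i w)).
  by apply: measurableT_comp => //; exact: measurable_funPT.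
have mS : measurable_fun [set: T] S by exact: measurable_sum.
have S0 w : (0 <= S w)%R by exact: sumr_ge0.
have ES : \int[P]_w (S w)%:E = (n%:R * m)%:E.
  under eq_integral do rewrite /S -sumEFin.
  rewrite ge0_integral_sum//; last 2 first.
  - by move=> i; exact/measurable_EFinP.
  - by move=> i w _; rewrite lee_fin.
  transitivity (\sum_(i < n) m%:E).
    apply: eq_bigr => i _; rewrite -fm.
    by apply: (integral_same_law (f := EFin \o f)) => //; exact/measurable_EFinP.
  by rewrite (sumEFin _ _ (fun=> m)) sumr_const card_ord mulr_natl.
have ES2 : \int[P]_w (S w ^+ 2)%:E = (n%:R * (v - m ^+ 2) + n%:R ^+ 2 * m ^+ 2)%:E.
  transitivity (\int[P]_w \sum_(i < n) \sum_(j < n) (f (X i w) * f (X j w))%:E).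
    apply: eq_integral => w _; rewrite expr2 /S mulr_suml -sumEFin.
    by apply: eq_bigr => i _; rewrite mulr_sumr -sumEFin.
  have mff i j : measurable_fun [set: T] (fun w => (f (X i w) * f (X j w))%:E).
    by apply/measurable_EFinP; exact: measurable_funM.
  have ff0 i j w : 0 <= (f (X i w) * f (X j w))%:E by rewrite lee_fin mulr_ge0.
  rewrite ge0_integral_sum//; last 2 first.
  - by move=> i; exact: emeasurable_sum.
  - by move=> i w _; exact: sume_ge0.
  transitivity (\sum_(i < n) \sum_(j < n) (m ^+ 2 + (i == j)%:R * (v - m ^+ 2))%:E).
    apply: eq_bigr => i _; rewrite ge0_integral_sum//; apply: eq_bigr => j _.
    have [<-|ij] := eqVneq i j.
      rewrite mul1r addrC subrK -fv.
      under eq_integral do rewrite -expr2.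
      apply: (integral_same_law (f := fun y => (f y ^+ 2)%:E)) => //.
        by apply/measurable_EFinP; exact: measurable_funX.
      by move=> y; rewrite lee_fin sqr_ge0.
    rewrite mul0r addr0 expr2 EFinM -fm.
    under eq_integral do rewrite EFinM.
    by apply: (integral_indep_mul (f := EFin \o f)) => //; exact/measurable_EFinP.
  transitivity (\sum_(i < n) (n%:R * m ^+ 2 + (v - m ^+ 2))%:E).
    apply: eq_bigr => i _; rewrite sumEFin; congr EFin.
    rewrite big_split/= sumr_const card_ord mulr_natl; congr (_ + _)%R.
    rewrite (bigD1 i)//= eqxx mul1r big1 ?addr0// => j /negbTE ji.
    by rewrite eq_sym ji mul0r.
  rewrite (sumEFin _ _ (fun=> _)) sumr_const card_ord -mulr_natl; congr EFin; ring.
have mSn : measurable_fun [set: T] (fun w => (S w - n%:R * m) ^+ 2)%R.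
  by apply: measurable_funX; exact: measurable_funB.
(* Moving the negative term of the square to the other side leaves only
   integrals of nonnegative functions. *)
have key : \int[P]_w ((S w - n%:R * m) ^+ 2)%:E + (2 * (n%:R * m) * (n%:R * m))%:E
    = (n%:R * (v - m ^+ 2) + n%:R ^+ 2 * m ^+ 2 + (n%:R * m) ^+ 2)%:E.
  have nm0 : (0 <= 2 * (n%:R * m))%R by rewrite !mulr_ge0.
  rewrite EFinM -ES -ge0_integralZl//; first last.
  - by move=> w _; rewrite lee_fin.
  - exact/measurable_EFinP.
  rewrite -ge0_integralD//; first last.
  - by apply: measurable_funeM; exact/measurable_EFinP.
  - by move=> w _; rewrite mule_ge0// lee_fin.
  - exact/measurable_EFinP.
  - by move=> w _; rewrite lee_fin sqr_ge0.
  transitivity (\int[P]_w ((S w ^+ 2)%:E + ((n%:R * m) ^+ 2)%:E)).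
    by apply: eq_integral => w _; rewrite -EFinM -!EFinD; congr EFin; ring.
  rewrite ge0_integralD//; first last.
  - by move=> w _; rewrite lee_fin sqr_ge0.
  - by apply/measurable_EFinP; exact: measurable_funX.
  - by move=> w _; rewrite lee_fin sqr_ge0.
  by rewrite ES2 integral_cst//= probability_setT mule1.
rewrite -(@leeD2rE _ (2 * (n%:R * m) * (n%:R * m))%:E)// key -EFinD lee_fin.
have : (0 <= n%:R * m ^+ 2)%R by rewrite mulr_ge0// sqr_ge0.
lra.
Qed.

End iid_moments.

(** * Laws of large numbers *)

Section subsequences.
Context {R : realType}.

Lemma exists_sqr_bounds (N : nat) : exists k, (k ^ 2 <= N < k.+1 ^ 2)%N.
Proof.
elim: N => [|N [k /andP[kN Nk]]]; first by exists 0%N.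
have [h|h] := leqP (k.+1 ^ 2) N.+1; last by exists k; rewrite h (leq_trans kN).
by exists k.+1; rewrite h/= (leq_ltn_trans Nk)// ltn_sqr.
Qed.

(** A nondecreasing sequence grows linearly as soon as it does so along the
    squares, because the ratio of consecutive squares tends to 1. *)
Lemma cvg_mean_squares (S : nat -> R) (m : R) : 0 <= m <= 1 ->
  {homo S : i j / (i <= j)%N >-> i <= j} ->
  ((S (k.+1 ^ 2)%N - (k.+1 ^ 2)%:R * m) / (k.+1 ^ 2)%:R) ^+ 2 @[k --> \oo]
    --> (0 : R) ->
  S N / N%:R @[N --> \oo] --> m.
Proof.
move=> /andP[m0 m1] Snd /cvgrPdist_le cv; apply/cvgrPdist_le => e e0.
have e5 : 0 < e / 5 by rewrite divr_gt0.
have e52 : 0 < (e / 5) ^+ 2 by rewrite exprn_gt0.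
have [K _ hK] := cv _ e52.
have {cv}hK k : (K < k)%N -> `|S (k ^ 2)%N - (k ^ 2)%:R * m| <= e / 5 * (k ^ 2)%:R.
  case: k => // k; rewrite ltnS => /hK.
  rewrite sub0r normrN ger0_norm ?sqr_ge0// -[leLHS]real_normK ?num_real//.
  rewrite ler_sqr ?nnegrE ?normr_ge0 ?(ltW e5)//.
  by rewrite normrM normfV [in X in _ / X <= _]ger0_norm ?ler0n// ler_pdivrMr// ltr0n.
(* For [k >= 15 / e] the relative gap [(2 * k + 1) / k ^ 2] between consecutive
   squares is at most [e / 5]. *)
pose L := Num.bound (15 / e).
exists ((maxn K L).+1 ^ 2)%N => // N /= hN.
have [k /andP[kN Nk]] := exists_sqr_bounds N.
have maxk : (maxn K L < k)%N.
  by rewrite -ltnS -ltn_sqr; exact: leq_ltn_trans hN Nk.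
have Kk : (K < k)%N := leq_ltn_trans (leq_maxl _ _) maxk.
have Lk : (L < k)%N := leq_ltn_trans (leq_maxr _ _) maxk.
have k0 : (0 < k)%N := leq_ltn_trans (leq0n _) Kk.
have k0r : 0 < k%:R :> R by rewrite ltr0n.
have N0 : 0 < N%:R :> R by rewrite ltr0n (leq_trans _ kN)// expn_gt0 k0.
have ke : 15 <= e * k%:R.
  rewrite mulrC -ler_pdivrMr//; have := archi_boundP (ltW (divr_gt0 (ltr0n R 15) e0)).
  by rewrite -/L => /ltW h; rewrite (le_trans h)// ler_nat ltnW.
have := hK k Kk; have := hK k.+1 (ltnW Kk).
have := Snd _ _ kN; have := Snd _ _ (ltnW Nk).
set s := S N; set s1 := S (k ^ 2)%N; set s2 := S _.
have : (k ^ 2)%:R <= N%:R :> R by rewrite ler_nat.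
have : N%:R <= (k.+1 ^ 2)%:R :> R by rewrite ler_nat ltnW.
rewrite !natrX -natr1 -/s2 !ler_norml => N2 N1 s2s s1s /andP[_ h2] /andP[h1 _].
rewrite -(mulfK (lt0r_neq0 N0) m) -mulrBl ler_pdivlMr// ler_pdivrMr//.
have k1 : 1 <= k%:R :> R by rewrite ler1n.
have kk : 15 * k%:R <= e * k%:R ^+ 2 by rewrite expr2 mulrA ler_pM2r.
have kk1 : k%:R <= k%:R ^+ 2 :> R by rewrite expr2 ler_peMr// ltW.
have eN : e * k%:R ^+ 2 <= e * N%:R by rewrite ler_pM2l.
have mN1 : m * k%:R ^+ 2 <= m * N%:R by rewrite ler_wpM2l.
have mN2 : m * N%:R <= m * (k%:R + 1) ^+ 2 by rewrite ler_wpM2l.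
have mk : m * k%:R <= k%:R by rewrite ler_piMl// ltW.
have ekk : e * k%:R <= e * k%:R ^+ 2 by rewrite ler_pM2l.
have ek1 : e <= e * k%:R by rewrite ler_peMr// ltW.
have E2 : (k%:R + 1) ^+ 2 = k%:R ^+ 2 + 2 * k%:R + 1 :> R by ring.
rewrite E2 in h2 mN2 *; move: h1 h2 mN2; rewrite !mulrDr !mulrDl => h1 h2 mN2.
apply/andP; split; lra.
Qed.

(** A geometric sum, dominated by its last term. *)
Lemma dyadic_sum_lt (z : R) K : 0 <= z ->
  \sum_(k < K) 2 ^+ k * (2 ^+ k < z)%R%:R <= 2 * z.
Proof.
move=> z0; have H : \sum_(k < K) 2 ^+ k * (2 ^+ k < z)%R%:R <= 2 * z /\
  \sum_(k < K) 2 ^+ k * (2 ^+ k < z)%R%:R <= 2 ^+ K :> R; last by case: H.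
elim: K => [|K [ih1 ih2]]; first by rewrite big_ord0 mulr_ge0.
have : 0 < 2 ^+ K :> R by rewrite exprn_gt0.
rewrite big_ord_recr/= exprS; move: ih1 ih2; set p := 2 ^+ K; set s := \sum_(_ < _) _.
by move=> s1 s2 p0; case: (ltP p z) => h; rewrite ?mulr1 ?mulr0; split; lra.
Qed.

(** A geometric sum, dominated by its first term. *)
Lemma dyadic_sum_ge (z : R) K : 0 <= z ->
  \sum_(k < K) z ^+ 2 / 2 ^+ k * (z <= 2 ^+ k)%R%:R <= 2 * z.
Proof.
move=> z0; suff : \sum_(k < K) z ^+ 2 / 2 ^+ k * (z <= 2 ^+ k)%R%:R <=
    if z <= 2 ^+ K then 2 * z - 2 * (z ^+ 2 / 2 ^+ K) else 0.
  move=> /le_trans; apply; case: ifP => _; last by rewrite mulr_ge0.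
  by rewrite lerBlDr lerDl mulr_ge0// divr_ge0 ?sqr_ge0// exprn_ge0.
elim: K => [|K ih].
  rewrite big_ord0 expr0 divr1; case: ifP => // z1.
  by rewrite subr_ge0 ler_pM2l// expr2 ler_piMr.
rewrite big_ord_recr/=.
have K0 : 0 < 2 ^+ K :> R by rewrite exprn_gt0.
have half : z ^+ 2 / 2 ^+ K.+1 = z ^+ 2 / 2 ^+ K / 2.
  by rewrite (exprS _ K) invfM mulrA mulrAC.
rewrite half; move: ih; case: (leP z (2 ^+ K)) => h ih.
  have -> : z <= 2 ^+ K.+1 by rewrite exprS; lra.
  by rewrite mulr1; lra.
rewrite mulr0 addr0; case: ifP => // h'; apply: (le_trans ih).
rewrite subr_ge0 mulrC divfK// ler_pdivrMr// expr2.
by rewrite -mulrA mulrCA ler_wpM2l// -exprS.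
Qed.

(** The first summands account for the second moments of the truncations at
    [2 ^ k], the second ones for the probabilities of being truncated. *)
Lemma dyadic_truncation_sum (z : R) K : 0 <= z ->
  \sum_(k < K) (Num.min z (2 ^+ k) ^+ 2 / 2 ^+ k + 2 ^+ k * (2 ^+ k < z)%R%:R)
  <= 6 * z.
Proof.
move=> z0; rewrite (le_trans (y := \sum_(k < K) (z ^+ 2 / 2 ^+ k * (z <= 2 ^+ k)%R%:R
   + 2 * (2 ^+ k * (2 ^+ k < z)%R%:R))))//.
  apply: ler_sum => k _; have K0 : 0 < 2 ^+ k :> R by rewrite exprn_gt0.
  case: (leP z (2 ^+ k)) => h; first by rewrite !mulr0 !addr0 mulr1.
  by rewrite (expr2 (2 ^+ k)) mulfK ?gt_eqF// mulr1 mulr0; lra.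
rewrite big_split/= -mulr_sumr.
have := dyadic_sum_lt K z0; have := dyadic_sum_ge K z0; lra.
Qed.

End subsequences.

Section strong_laws.
Context d (T : measurableType d) (R : realType) (P : probability T R).
Variables (X : nat -> {RV P >-> R}) (Y : {RV P >-> R}).
Hypothesis X_law : forall n, same_law (X n) Y.
Hypothesis X_indep : pairwise_independent X.

Lemma integral_bounded_fin (f : R -> R) (M : R) : measurable_fun [set: R] f ->
  (forall y, 0 <= f y <= M) ->
  exists2 c : R, 0 <= c <= M & (\int[P]_w (f (Y w))%:E)%E = c%:E.
Proof.
move=> mf fM; have f0 y : 0 <= f y by have /andP[] := fM y.
have I0 : (0 <= \int[P]_w (f (Y w))%:E)%E.
  by apply: integral_ge0 => w _; rewrite lee_fin.
have IM : (\int[P]_w (f (Y w))%:E <= M%:E)%E.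
  rewrite (@le_trans _ _ (\int[P]_w M%:E)%E)//; last first.
    by rewrite integral_cst//= probability_setT mule1.
  apply: ge0_le_integral => //.
  - by move=> w _; rewrite lee_fin.
  - by apply/measurable_EFinP; apply: measurableT_comp.
  - by move=> w _; rewrite lee_fin; have /andP[] := fM (Y w).
have Ifin : (\int[P]_w (f (Y w))%:E)%E \is a fin_num.
  by rewrite ge0_fin_numE// (le_lt_trans IM)// ltry.
exists (fine (\int[P]_w (f (Y w))%:E)%E); last by rewrite fineK.
by rewrite -!lee_fin fineK// I0 IM.
Qed.

(** The strong law of large numbers for bounded variables: Chebyshev along the
    squares. *)
Theorem strong_law_bounded (f : R -> R) (m : R) : measurable_fun [set: R] f ->
  (forall y, 0 <= f y <= 1) -> (\int[P]_w (f (Y w))%:E)%E = m%:E ->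
  {ae P, forall w, (\sum_(i < N) f (X i w)) / N%:R @[N --> \oo] --> m}.
Proof.
move=> mf f01 fm; have f0 y : 0 <= f y by have /andP[] := f01 y.
have [m' m01 ] := integral_bounded_fin mf f01.
rewrite fm => -[mm']; rewrite -{m'}mm' in m01.
have mf2 : measurable_fun [set: R] (fun y => f y ^+ 2) by exact: measurable_funX.
have f201 y : 0 <= f y ^+ 2 <= 1.
  by rewrite sqr_ge0/= exprn_ile1//; have /andP[] := f01 y.
have [v /andP[v0 v1] fv] := integral_bounded_fin mf2 f201.
pose S w N := \sum_(i < N) f (X i w).
pose g k w := ((S w (k.+1 ^ 2)%N - (k.+1 ^ 2)%:R * m) / (k.+1 ^ 2)%:R) ^+ 2.
have mS n : measurable_fun [set: T] (S ^~ n).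
  by apply: measurable_sum => i; apply: measurableT_comp => //; exact: measurable_funPT.
have mg k : measurable_fun [set: T] (g k).
  by apply: measurable_funX; apply: measurable_funM => //; exact: measurable_funB.
have gk k : (\int[P]_w (g k w)%:E <= ((k.+1 ^ 2)%:R^-1)%:E)%E.
  have := variance_iid_sum X_law X_indep (k.+1 ^ 2) mf f0 fm fv.
  set n := (k.+1 ^ 2)%N; have n0 : 0 < n%:R :> R by rewrite ltr0n expn_gt0.
  move=> h; rewrite (_ : (fun w => _) = fun w =>
    ((n%:R ^- 2)%:E * ((S w n - n%:R * m) ^+ 2)%:E)%E); last first.
    by apply/funext => w; rewrite /g -/n -EFinM expr_div_n mulrC.
  rewrite ge0_integralZl//; first last.
  - by move=> w _; rewrite lee_fin sqr_ge0.
  - by apply/measurable_EFinP; apply: measurable_funX; exact: measurable_funB.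
  apply: (@le_trans _ _ ((n%:R ^- 2)%:E * (n%:R * v)%:E)%E).
    by rewrite lee_pmul2l ?lte_fin ?invr_gt0 ?exprn_gt0.
  rewrite -EFinM lee_fin -exprVn expr2 -mulrA (mulrA _ n%:R) mulVf ?gt_eqF// mul1r.
  by rewrite ler_piMr// invr_ge0 ltW.
(* [1 / a ^ 2 <= 2 * (1 / a - 1 / (a + 1))] telescopes. *)
have sumg K : (\sum_(k < K) \int[P]_w (g k w)%:E <= 2%:E)%E.
  apply: (@le_trans _ _ (\sum_(k < K) ((k.+1 ^ 2)%:R^-1 : R)%:E)%E).
    by apply: lee_sum => k _; exact: gk.
  rewrite sumEFin lee_fin.
  have : \sum_(k < K) ((k.+1 ^ 2)%:R^-1 : R) <= 2 * (1 - (K.+1)%:R^-1).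
    elim: K => [|K ih]; first by rewrite big_ord0 invr1 subrr mulr0.
    rewrite big_ord_recr/= (le_trans (lerD ih (lexx _)))//.
    have a1 : 1 <= K.+1%:R :> R by rewrite ler1n.
    rewrite -(natr1 K.+1) natrX; set a := K.+1%:R in a1 *.
    have a0 : 0 < a by lra.
    rewrite -subr_ge0.
    have -> : 2 * (1 - (a + 1)^-1) - (2 * (1 - a^-1) + (a ^+ 2)^-1) =
        (a - 1) / (a ^+ 2 * (a + 1)).
      by field; rewrite !gt_eqF// addr_gt0.
    by rewrite divr_ge0 ?subr_ge0// mulr_ge0 ?sqr_ge0// addr_ge0// ltW.
  by move=> /le_trans; apply; rewrite -[leRHS]mulr1 ler_pM2l// gerBl invr_ge0.
have := ae_cvg0_summable_integral mg (fun k w => sqr_ge0 _) sumg.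
apply: filterS => w; apply: cvg_mean_squares => //.
by apply: homo_leq => [//|y x z|n]; [exact: le_trans|rewrite /S big_ord_recr/= lerDl].
Qed.

End strong_laws.

Section maximal_law.
Context d (T : measurableType d) (R : realType) (P : probability T R).
Variables (X : nat -> {RV P >-> R}) (Y : {RV P >-> R}).
Hypothesis X_law : forall n, same_law (X n) Y.
Hypothesis X_indep : pairwise_independent X.

(** An upper bound for the averages of nonnegative integrable variables, with
    a spurious factor 2. Along the powers of 2 the summands are truncated at
    the number of summands; the truncation error and the variances are summable
    over the powers of 2, by [dyadic_truncation_sum]. The factor 2 comes from
    rounding the number of summands up to a power of 2. *)
Theorem upper_law_integrable (f : R -> R) (m : R) : measurable_fun [set: R] f ->
  (forall y, 0 <= f y) -> (\int[P]_w (f (Y w))%:E)%E = m%:E ->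
  {ae P, forall w, forall e, 0 < e ->
    \forall N \near \oo, \sum_(i < N) f (X i w) <= N%:R * (2 * (m + e))}.
Proof.
move=> mf f0 fm.
pose t k y := Num.min (f y) (2 ^+ k).
pose b k y := (2 ^+ k < f y)%R%:R : R.
have mt k : measurable_fun [set: R] (t k) by exact: measurable_minr.
have mb k : measurable_fun [set: R] (b k).
  rewrite (_ : b k = \1_(f @^-1` `]2 ^+ k, +oo[)).
    by apply: measurable_indic; rewrite -[X in measurable X]setTI; exact: mf.
  apply/funext => y; rewrite /b indicE; congr (nat_of_bool _)%:R.
  by apply/idP/idP; rewrite inE/= in_itv/= andbT.
have p0 k : 0 < 2 ^+ k :> R by rewrite exprn_gt0.
have t0 k y : 0 <= t k y <= 2 ^+ k.
  by rewrite ge_min lexx orbT andbT le_min f0/= ltW.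
have tge0 k y : 0 <= t k y by have /andP[] := t0 k y.
have mtsq k : measurable_fun [set: R] (fun y => t k y ^+ 2) by exact: measurable_funX.
have tsq k y : 0 <= t k y ^+ 2 <= (2 ^+ k) ^+ 2.
  by rewrite sqr_ge0/= ler_sqr ?nnegrE ?tge0 ?(ltW (p0 k))//; have /andP[] := t0 k y.
have b0 k y : 0 <= b k y by rewrite ler0n.
have /choice[mu muP] : forall k, exists c : R,
    c <= m /\ (\int[P]_w (t k (Y w))%:E)%E = c%:E.
  move=> k; have [c _ hc] := integral_bounded_fin (P := P) Y (mt k) (t0 k).
  exists c; split => //; rewrite -lee_fin -hc -fm.
  apply: ge0_le_integral => //.
  - by move=> w _; rewrite lee_fin.
  - by apply/measurable_EFinP; apply: measurableT_comp.
  - by apply/measurable_EFinP; apply: measurableT_comp.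
  - by move=> w _; rewrite lee_fin ge_min lexx.
have /choice[v vP] : forall k, exists c : R, (\int[P]_w ((t k (Y w)) ^+ 2)%:E)%E = c%:E.
  move=> k; have [c _ hc] := integral_bounded_fin (P := P) Y (mtsq k) (tsq k).
  by exists c.
(* [g1] is the squared relative deviation of the truncated sum, [g2] the number
   of truncated summands. *)
pose S k w := \sum_(i < 2 ^ k) t k (X i w).
pose g1 k w := ((S k w - (2 ^ k)%:R * mu k) / 2 ^+ k) ^+ 2.
pose g2 k w := \sum_(i < 2 ^ k) b k (X i w).
have mX (h : R -> R) i : measurable_fun [set: R] h ->
    measurable_fun [set: T] (fun w => h (X i w)).
  by move=> mh; apply: measurableT_comp => //; exact: measurable_funPT.
have mS k : measurable_fun [set: T] (S k).
  by apply: measurable_sum => i; exact: mX.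
have mD k : measurable_fun [set: T] (fun w => (S k w - (2 ^ k)%:R * mu k) ^+ 2).
  by apply: measurable_funX; exact: measurable_funB.
have mg1 k : measurable_fun [set: T] (g1 k).
  by apply: measurable_funX; apply: measurable_funM => //; exact: measurable_funB.
have mg2 k : measurable_fun [set: T] (g2 k).
  by apply: measurable_sum => i; exact: mX.
have g10 k w : 0 <= g1 k w by rewrite sqr_ge0.
have g20 k w : 0 <= g2 k w by exact: sumr_ge0.
have Ig1 k : (\int[P]_w (g1 k w)%:E <= \int[P]_w (t k (Y w) ^+ 2 / 2 ^+ k)%:E)%E.
  have := variance_iid_sum X_law X_indep (2 ^ k) (mt k) (tge0 k) (muP k).2 (vP k).
  move=> h; have c0 : (0 <= ((2 ^+ k) ^- 2)%:E :> \bar R)%E.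
    by rewrite lee_fin invr_ge0 exprn_ge0// ltW.
  rewrite (_ : (fun w => (g1 k w)%:E) = fun w => (((2 ^+ k) ^- 2)%:E *
     ((S k w - (2 ^ k)%:R * mu k) ^+ 2)%:E)%E); last first.
    by apply/funext => w; rewrite /g1 -EFinM expr_div_n mulrC.
  rewrite [leLHS]ge0_integralZl//; last 2 first.
  - exact/measurable_EFinP.
  - by move=> w _; rewrite lee_fin sqr_ge0.
  rewrite (le_trans (lee_wpmul2l c0 h))//.
  rewrite (_ : (fun w => _) =
    fun w => ((2 ^+ k)^-1%:E * (t k (Y w) ^+ 2)%:E)%E); last first.
    by apply/funext => w; rewrite -EFinM mulrC.
  rewrite [leRHS]ge0_integralZl//; last 2 first.
  - by apply/measurable_EFinP; apply: (measurableT_comp (mtsq k)).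
  - by move=> w _; rewrite lee_fin sqr_ge0.
  rewrite vP -!EFinM lee_fin natrX le_eqVlt; apply/orP; left; apply/eqP.
  by field; exact: lt0r_neq0.
have Ig2 k : (\int[P]_w (g2 k w)%:E = \int[P]_w (2 ^+ k * b k (Y w))%:E)%E.
  under eq_integral do rewrite -sumEFin.
  rewrite ge0_integral_sum//; last 2 first.
  - by move=> i; apply/measurable_EFinP; exact: mX.
  - by move=> i w _; rewrite lee_fin.
  transitivity (\sum_(i < 2 ^ k) \int[P]_w (b k (Y w))%:E)%E.
    apply: eq_bigr => i _.
    apply: (integral_same_law (f := EFin \o b k)) => // [|y].
      exact/measurable_EFinP.
    by rewrite lee_fin.
  have -> : (\sum_(i < 2 ^ k) \int[P]_w (b k (Y w))%:E =
      (2 ^+ k)%:E * \int[P]_w (b k (Y w))%:E)%E.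
    have b01 y : 0 <= b k y <= 1 by rewrite b0/= lern1 leq_b1.
    have [c _ ->] := integral_bounded_fin (P := P) Y (mb k) b01.
    by rewrite (sumEFin _ _ (fun=> c)) sumr_const card_ord -EFinM -natrX mulr_natl.
  rewrite -ge0_integralZl//; last 2 first.
  - by apply/measurable_EFinP; apply: measurableT_comp.
  - by move=> w _; rewrite lee_fin.
have sumg K : (\sum_(k < K) \int[P]_w (g1 k w + g2 k w)%:E <= (6 * m)%:E)%E.
  pose q k w := t k (Y w) ^+ 2 / 2 ^+ k + 2 ^+ k * b k (Y w).
  have mq1 k : measurable_fun [set: T] (fun w => t k (Y w) ^+ 2 / 2 ^+ k).
    by apply: measurable_funM => //; apply: measurable_funX; apply: measurableT_comp.
  have mq2 k : measurable_fun [set: T] (fun w => 2 ^+ k * b k (Y w)).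
    by apply: measurable_funM => //; apply: measurableT_comp.
  have q10 k w : 0 <= t k (Y w) ^+ 2 / 2 ^+ k by rewrite divr_ge0 ?sqr_ge0// ltW.
  have q20 k w : 0 <= 2 ^+ k * b k (Y w) by rewrite mulr_ge0// ltW.
  apply: (@le_trans _ _ (\sum_(k < K) \int[P]_w (q k w)%:E)%E).
    apply: lee_sum => k _.
    under eq_integral do rewrite EFinD.
    rewrite ge0_integralD//; last 4 first.
    - by move=> w _; rewrite lee_fin.
    - exact/measurable_EFinP.
    - by move=> w _; rewrite lee_fin.
    - exact/measurable_EFinP.
    under [leRHS]eq_integral do rewrite EFinD.
    rewrite [leRHS]ge0_integralD//; last 4 first.
    - by move=> w _; rewrite lee_fin.
    - exact/measurable_EFinP.
    - by move=> w _; rewrite lee_fin.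
    - exact/measurable_EFinP.
    by rewrite Ig2 leeD2r.
  rewrite -ge0_integral_sum//; last 2 first.
  - by move=> i; apply/measurable_EFinP; exact: measurable_funD.
  - by move=> i w _; rewrite lee_fin addr_ge0.
  rewrite EFinM -fm -ge0_integralZl//; last 2 first.
  - by apply/measurable_EFinP; apply: measurableT_comp.
  - by move=> w _; rewrite lee_fin.
  apply: ge0_le_integral => //.
  - by move=> w _; apply: sume_ge0 => i _; rewrite lee_fin addr_ge0.
  - by apply: emeasurable_sum => i; apply/measurable_EFinP; exact: measurable_funD.
  - by apply: measurable_funeM; apply/measurable_EFinP; apply: measurableT_comp.
  - by move=> w _; rewrite sumEFin -EFinM lee_fin; exact: dyadic_truncation_sum.
have mg k : measurable_fun [set: T] (fun w => g1 k w + g2 k w).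
  exact: measurable_funD.
have := ae_cvg0_summable_integral mg (fun k w => addr_ge0 (g10 k w) (g20 k w)) sumg.
apply: filterS => w /cvgrPdist_lt cv e e0.
have [K _ hK] : \forall k \near \oo, \sum_(i < 2 ^ k) f (X i w) <= (2 ^ k)%:R * (m + e).
  have e1 : 0 < Num.min 1 (e ^+ 2) by rewrite lt_min ltr01 exprn_gt0.
  apply: filterS (cv _ e1) => k.
  rewrite sub0r normrN ger0_norm ?addr_ge0// lt_min => /andP[g1lt geps].
  (* The number of truncated summands is less than 1, hence 0. *)
  have tf (i : 'I_(2 ^ k)) : t k (X i w) = f (X i w).
    apply/min_idPl; rewrite leNgt; apply/negP => h.
    have : 1 <= g2 k w.
      rewrite /g2 (bigD1 i)//= {1}/b h lerDl; exact: sumr_ge0.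
    by rewrite leNgt (le_lt_trans _ g1lt)// lerDr.
  have : g1 k w < e ^+ 2 by rewrite (le_lt_trans _ geps)// lerDl.
  rewrite /g1 -natrX -[ltLHS]real_normK ?num_real//.
  rewrite ltr_sqr ?nnegrE ?normr_ge0 ?(ltW e0)//.
  move=> /(le_lt_trans (ler_norm _)).
  rewrite ltr_pdivrMr ?ltr0n ?expn_gt0// => h.
  have -> : \sum_(i < 2 ^ k) f (X i w) = S k w by apply: eq_bigr => i _; rewrite tf.
  have : (2 ^ k)%:R * mu k <= (2 ^ k)%:R * m by rewrite ler_wpM2l// (muP k).1.
  by move: h; rewrite mulrDr (mulrC e); lra.
exists (2 ^ K)%N => // N /= KN.
have N0 : (0 < N)%N by rewrite (leq_trans _ KN)// expn_gt0.
have /andP[kN Nk] := trunc_log_bounds (ltnSn 1) N0; set k := trunc_log 2 N in kN Nk.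
have Kk : (K <= k.+1)%N.
  by rewrite -(@leq_exp2l 2)// (leq_trans KN)// ltnW.
have nd : {homo (fun n => \sum_(i < n) f (X i w)) : i j / (i <= j)%N >-> i <= j}.
  by apply: homo_leq => [//|y x z|n]; [exact: le_trans|rewrite big_ord_recr/= lerDl].
apply: le_trans (nd _ _ (ltnW Nk)) _; apply: le_trans (hK _ Kk) _.
have m0 : 0 <= m by rewrite -lee_fin -fm integral_ge0// => z _; rewrite lee_fin.
rewrite mulrA ler_pM2r; last by rewrite ltr_wpDl.
by rewrite expnS mulnC natrM ler_pM2r// ler_nat.
Qed.

End maximal_law.

(** * Convergence in mean of realisations of the sample *)

Section discretization.
Context {R : realType}.

(** The staircase with steps of height [dlt] at the multiples of [dlt] below
    [K * dlt] approximates the identity up to [dlt] between 0 and [K * dlt]. *)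
Lemma staircase_approx (dlt a : R) (K : nat) : 0 <= dlt ->
  `|\sum_(j < K) dlt * (j%:R * dlt < a)%R%:R - a|
  <= dlt + (Num.max 0 (- a) + Num.max 0 (a - K%:R * dlt)).
Proof.
move=> d0; have max0 (x : R) : 0 <= Num.max 0 x by rewrite le_max lexx.
have maxx (x : R) : x <= Num.max 0 x by rewrite le_max lexx orbT.
have [a0|a0] := leP a 0.
  rewrite big1 => [|j _].
    rewrite sub0r normrN ler0_norm//.
    by have := maxx (- a); have := max0 (a - K%:R * dlt); lra.
  by rewrite ltNge (le_trans a0)//= ?mulr0// mulr_ge0.
have [small large] : (a <= K%:R * dlt ->
     a <= \sum_(j < K) dlt * (j%:R * dlt < a)%R%:R <= a + dlt) /\
   (K%:R * dlt < a ->
     \sum_(j < K) dlt * (j%:R * dlt < a)%R%:R = K%:R * dlt).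
  elim: K => [|K [ih1 ih2]].
    by rewrite big_ord0 mul0r; split => //; rewrite leNgt a0.
  rewrite big_ord_recr/= -natr1 mulrDl mul1r; move: ih1 ih2.
  set s := \sum_(_ < _) _; set p := K%:R * dlt => ih1 ih2.
  have [h|h] := leP a p.
    by rewrite mulr0 addr0; split => h'; [exact: ih1|lra].
  by rewrite (ih2 h) mulr1; split => // ?; apply/andP; split; lra.
have m1 := max0 (- a); have m2 := max0 (a - K%:R * dlt).
have m3 := maxx (a - K%:R * dlt).
have [h|h] := leP a (K%:R * dlt).
  by have /andP[h1 h2] := small h; rewrite ger0_norm ?subr_ge0//; lra.
by rewrite (large h) ltr0_norm ?subr_lt0//; lra.
Qed.

(** The points of a grid of mesh [1 / n.+1] starting at [- n.+1]; the first
    [2 * n.+1 ^ 2] of them cover the interval from [- n.+1] to [n.+1]. *)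
Definition grid (n j : nat) : R := j%:R * n.+1%:R^-1 - n.+1%:R.

(** The part of [`|a|] beyond the range of the [n]-th grid. *)
Definition tail (n : nat) (a : R) : R := Num.max 0 (`|a| - n.+1%:R).

Lemma tail_ge0 n a : 0 <= tail n a.
Proof. by rewrite /tail le_max lexx. Qed.

(** The number of separating grid points controls the distance, up to the mesh
    and to what exceeds the range of the grid. *)
Lemma dist_le_grid (n : nat) (a b : R) :
  `|a - b| <= 2 * n.+1%:R^-1 + tail n a + tail n b +
    \sum_(j < 2 * n.+1 ^ 2) n.+1%:R^-1 *
      `|(grid n j < a)%R%:R - (grid n j < b)%R%:R|.
Proof.
set dlt := n.+1%:R^-1; set K := (2 * _)%N; pose M : R := n.+1%:R.
have M0 : 0 < M by rewrite ltr0n.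
have d0 : 0 <= dlt by rewrite invr_ge0 ltW.
have KM : K%:R * dlt = 2 * M.
  by rewrite /K natrM natrX expr2 mulrA mulfK// gt_eqF.
pose c x : R := \sum_(j < K) dlt * (grid n j < x)%R%:R.
have approx x : `|c x - (x + M)| <= dlt + tail n x.
  have := staircase_approx (x + M) K d0; rewrite KM.
  under eq_bigr do rewrite -ltrBlDr -/(grid n _).
  move=> /le_trans; apply; rewrite lerD2l /tail -/M.
  have max0 : 0 <= Num.max 0 (`|x| - M) by rewrite le_max lexx.
  have maxx : `|x| - M <= Num.max 0 (`|x| - M) by rewrite le_max lexx orbT.
  have x1 := ler_norm x; have := ler_norm (- x); rewrite normrN => x2.
  by case: (leP 0 (- (x + M))) => h1; case: (leP 0 (x + M - 2 * M)) => h2; lra.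
have cab : `|c a - c b| <=
    \sum_(j < K) dlt * `|(grid n j < a)%R%:R - (grid n j < b)%R%:R|.
  rewrite /c -sumrB (le_trans (ler_norm_sum _ _ _))//.
  by apply: ler_sum => j _; rewrite -mulrBr normrM ger0_norm.
have -> : a - b = - (c a - (a + M)) + (c a - c b) + (c b - (b + M)) by ring.
have := ler_normD (- (c a - (a + M)) + (c a - c b)) (c b - (b + M)).
have := ler_normD (- (c a - (a + M))) (c a - c b).
rewrite normrN; have := approx a; have := approx b; lra.
Qed.

End discretization.

Section sample_convergence.
Context d (T : measurableType d) (R : realType) (P : probability T R).
Hypothesis P_atomless : atomless P.
Variables (X : nat -> {RV P >-> R}) (Y : {RV P >-> R}).
Hypothesis X_law : forall n, same_law (X n) Y.
Hypothesis X_indep : pairwise_independent X.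

(** Integrals against the empirical distribution are sample means. *)
Lemma integral_sample (eta : {RV P >-> R}) w N (h : R -> R) :
  has_law eta (sample_distribution X w N) ->
  measurable_fun [set: R] h -> (forall y, 0 <= h y) ->
  (\int[P]_w' (h (eta w'))%:E = ((\sum_(i < N) h (X i w)) / N%:R)%:E)%E.
Proof.
move=> eta_law mh h0.
rewrite -(ge0_integral_distribution eta (f := EFin \o h))//; last first.
  exact/measurable_EFinP.
rewrite (eq_measure_integral (sample_distribution X w N)); last first.
  by move=> A mA _; exact: eta_law.
have mEh : measurable_fun [set: R] (EFin \o h) by exact/measurable_EFinP.
have Eh0 y : [set: R] y -> (0 <= (EFin \o h) y)%E by rewrite lee_fin.
rewrite ge0_integral_mscale//= ge0_integral_measure_sum//.
rewrite mulrC EFinM -sumEFin; congr (_ * _)%E; apply: eq_bigr => i _.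
by rewrite integral_dirac// diracT mul1e.
Qed.

Lemma integral_tail_cvg0 (V : T -> R) : measurable_fun [set: T] V ->
  (\int[P]_w `|V w|%:E < +oo)%E ->
  (\int[P]_w (tail n (V w))%:E @[n --> \oo] --> (0 : \bar R))%E.
Proof.
move=> mV intV.
have max0 (x : R) : 0 <= Num.max 0 x by rewrite le_max lexx.
have -> : (0 = \int[P]_w (cst 0 w) :> \bar R)%E by rewrite integral0.
apply: (@dominated_cvg _ _ _ P setT measurableT _ _ (fun w => `|V w|%:E)) => //.
- move=> n; apply/measurable_EFinP; apply: measurable_maxr => //.
  by apply: measurable_funB => //; apply: measurableT_comp.
- move=> w _; apply/cvg_EFin; first by near=> n.
  apply: cvg_near_cst; near=> n; rewrite /= /tail max_l// subr_le0.
  have : (Num.bound `|V w| <= n)%N by near: n; exact: nbhs_infty_ge.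
  move=> h; rewrite ltW// (lt_le_trans (archi_boundP _))// ler_nat.
  exact: leq_trans h _.
- apply/integrableP; split.
    by apply/measurable_EFinP; apply: measurableT_comp.
  by under eq_integral do rewrite /= normr_id.
- move=> n w _; rewrite lee_fin ger0_norm ?tail_ge0// /tail ge_max normr_ge0/=.
  by rewrite gerBl.
Unshelve. all: by end_near. Qed.

(** Almost surely the empirical distributions admit realisations [eta] for
    which [G eta] tends to [G Y] in mean. Each realisation is comonotone with
    [Y], so a grid point [x] separates [G eta] from [G Y] with probability equal
    to the difference between the empirical and the true probability of
    [x < G y]. The strong law makes this small, and [upper_law_integrable]
    controls what the grid misses. *)
Theorem ae_sample_coupling_cvg (G : R -> R) :
  {homo G : x y / x <= y} -> (\int[P]_w `|G (Y w)|%:E < +oo)%E ->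
  {ae P, forall w, forall e, 0 < e -> \forall N \near \oo,
    exists eta : {RV P >-> R}, [/\ exists M, forall w', `|eta w'| <= M,
      has_law eta (sample_distribution X w N) &
      (\int[P]_w' `|G (eta w') - G (Y w')|%:E <= e%:E)%E]}.
Proof.
move=> Gnd intG.
have mG : measurable_fun [set: R] G by exact: nondecreasing_measurable.
have mtail n : measurable_fun [set: R] (fun y => tail n (G y)).
  apply: measurable_maxr => //; apply: measurable_funB => //.
  exact: measurableT_comp.
pose ind n j y : R := (grid n j < G y)%R%:R.
have mind n j : measurable_fun [set: R] (ind n j).
  rewrite (_ : ind n j = \1_(G @^-1` `]grid n j, +oo[)).
    by apply: measurable_indic; rewrite -[X in measurable X]setTI; exact: mG.
  apply/funext => y; rewrite /ind indicE; congr (nat_of_bool _)%:R.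
  by apply/idP/idP; rewrite inE/= in_itv/= andbT.
have ind01 n j y : 0 <= ind n j y <= 1 by rewrite /ind ler0n lern1 leq_b1.
have mGY : measurable_fun [set: T] (G \o Y) by apply: measurableT_comp.
have /choice[m mP] : forall n, exists c : R,
    (\int[P]_w (tail n (G (Y w)))%:E)%E = c%:E.
  move=> n; eexists; rewrite -[LHS]fineK//.
  have t0 : (0 <= \int[P]_w (tail n (G (Y w)))%:E)%E.
    by apply: integral_ge0 => w _; rewrite lee_fin tail_ge0.
  rewrite ge0_fin_numE// (le_lt_trans _ intG)//; apply: ge0_le_integral => //.
  - by move=> w _; rewrite lee_fin tail_ge0.
  - by apply/measurable_EFinP; apply: (measurableT_comp (mtail n)).
  - by apply/measurable_EFinP; apply: measurableT_comp.
  - by move=> w _; rewrite lee_fin /tail ge_max normr_ge0/= gerBl.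
have m_cvg0 : m n @[n --> \oo] --> (0 : R).
  have := integral_tail_cvg0 mGY intG.
  by under eq_fun do rewrite mP; exact: fine_cvg.
have /choice[q /all_and2[q01 qP]] : forall nj : nat * nat, exists c : R, 0 <= c <= 1 /\
    (\int[P]_w (ind nj.1 nj.2 (Y w))%:E)%E = c%:E.
  move=> [n j]; have [c ? ?] := integral_bounded_fin Y (mind n j) (ind01 n j).
  by exists c.
have ae_tail : {ae P, forall w, forall n, forall e, 0 < e -> \forall N \near \oo,
    \sum_(i < N) tail n (G (X i w)) <= N%:R * (2 * (m n + e))}.
  apply: ae_foralln => n; apply: (upper_law_integrable X_law X_indep (mtail n)) => //.
  by move=> y; exact: tail_ge0.
have ae_grid : {ae P, forall w, forall n j,
    (\sum_(i < N) ind n j (X i w)) / N%:R @[N --> \oo] --> q (n, j)}.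
  apply: ae_foralln => n; apply: ae_foralln => j.
  exact: (strong_law_bounded X_law X_indep (mind n j)) (qP (n, j)).
apply: filterS2 ae_tail ae_grid => w htail hgrid e e0.
have e16 : 0 < e / 16 by rewrite divr_gt0.
have [n [nm nd]] : exists n, m n <= e / 16 /\ n.+1%:R^-1 <= e / 16.
  have [n1 _ h1] : \forall n \near \oo, `|m n| <= e / 16.
    move/cvgrPdist_le : m_cvg0 => /(_ _ e16); apply: filterS => n.
    by rewrite sub0r normrN.
  pose n2 := Num.bound (e / 16)^-1; exists (n1 + n2)%N; split.
    by rewrite (le_trans (ler_norm _))// h1//= leq_addr.
  have hb : (e / 16)^-1 < n2%:R by apply: archi_boundP; rewrite invr_ge0 ltW.
  rewrite invf_ple ?posrE ?ltr0n// (le_trans (ltW hb))// ler_nat.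
  by rewrite (leq_trans (leq_addl n1 _)).
have a0 : 0 < n.+1%:R :> R by rewrite ltr0n.
(* The [2 * n.+1 ^ 2] grid points, weighted by the mesh, then contribute at most
   [e / 4]. *)
pose e' := e / 8 / n.+1%:R.
have e'0 : 0 < e' by rewrite !divr_gt0.
have hgrid' : \forall N \near \oo, forall j : 'I_(2 * n.+1 ^ 2),
    `|(\sum_(i < N) ind n j (X i w)) / N%:R - q (n, val j)| <= e'.
  apply: filter_forall => j; have /cvgrPdist_le/(_ _ e'0) := hgrid n j.
  by apply: filterS => N; rewrite distrC.
near=> N.
have N0 : (0 < N)%N by near: N; exact: nbhs_infty_gt.
have N0r : 0 < N%:R :> R by rewrite ltr0n.
have tailN : \sum_(i < N) tail n (G (X i w)) <= N%:R * (2 * (m n + e / 16)).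
  by near: N; exact: htail.
have gridN : forall j : 'I_(2 * n.+1 ^ 2),
    `|(\sum_(i < N) ind n j (X i w)) / N%:R - q (n, val j)| <= e'.
  by near: N.
have [eta [eta_bnd eta_law eta_com]] :=
  exists_comonotone_sample P_atomless Y (fun i => X i w) N0.
exists eta; split => //.
have mGe : measurable_fun [set: T] (G \o eta).
  by apply: measurableT_comp => //; exact: measurable_funPT.
have com : comonotone (G \o eta) (G \o Y).
  move=> w1 w2 /= h; apply/Gnd/eta_com; rewrite ltNge; apply/negP => /Gnd.
  by rewrite leNgt h.
pose sep j w' : R := `|(grid n j < G (eta w'))%R%:R - (grid n j < G (Y w'))%R%:R|.
have msep j : measurable_fun [set: T] (sep j).
  apply: measurableT_comp => //; apply: measurable_funB.
  - by apply: (measurableT_comp (mind n j)).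
  - by apply: (measurableT_comp (mind n j)).
have Isep (j : 'I_(2 * n.+1 ^ 2)) : (\int[P]_w' (sep j w')%:E <= e'%:E)%E.
  rewrite [leLHS](comonotone_indic P (grid n j) mGe mGY com) lee_fin.
  suff E (U : {RV P >-> R}) c : (\int[P]_w' (ind n j (U w'))%:E = c%:E)%E ->
      prob P [set w' | grid n j < G (U w')] = c.
    rewrite (E eta ((\sum_(i < N) ind n j (X i w)) / N%:R)) ?(E Y (q (n, val j)))//.
      exact: qP (n, val j).
    by apply: integral_sample => // y; have /andP[] := ind01 n j y.
  move=> Uc; apply: EFin_inj; rewrite -Uc.
  have mU : measurable [set w' | grid n j < G (U w')].
    rewrite (_ : [set _ | _] = (G \o U) @^-1` `]grid n j, +oo[).
      rewrite -[X in measurable X]setTI.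
      by apply: (measurableT_comp mG) => //; exact: measurable_funPT.
    by apply/seteqP; split => w' /=; rewrite in_itv/= andbT.
  rewrite EFin_prob// -[X in P X]setIT -integral_indic//.
  apply: eq_integral => w' _; rewrite indicE /ind; congr (nat_of_bool _)%:R%:E.
  by apply/idP/idP; rewrite inE.
pose dlt : R := n.+1%:R^-1.
have d0 : 0 <= dlt by rewrite invr_ge0 ltW.
pose bound w' : \bar R := ((2 * dlt)%:E + (tail n (G (eta w')))%:E +
  (tail n (G (Y w')))%:E +
  \sum_(j < 2 * n.+1 ^ 2) (dlt%:E * (sep j w')%:E))%E.
have mtU (U : {RV P >-> R}) :
    measurable_fun [set: T] (fun w' => (tail n (G (U w')))%:E).
  apply/measurable_EFinP; apply: (measurableT_comp (mtail n)).
  exact: measurable_funPT.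
have sepr0 j w' : 0 <= sep j w' by exact: normr_ge0.
have sep0 j w' : (0 <= (sep j w')%:E)%E by rewrite lee_fin.
have tl0 a : (0 <= (tail n a)%:E :> \bar R)%E by rewrite lee_fin tail_ge0.
have mdsep j : measurable_fun [set: T] (fun w' => (dlt%:E * (sep j w')%:E)%E).
  by apply: measurable_funeM; exact/measurable_EFinP.
have dsep0 j w' : (0 <= dlt%:E * (sep j w')%:E)%E by rewrite -EFinM lee_fin mulr_ge0.
have d20 : (0 <= (2 * dlt)%:E)%E by rewrite lee_fin mulr_ge0.
apply: (@le_trans _ _ (\int[P]_w' bound w')%E).
  apply: ge0_le_integral => //.
  - apply/measurable_EFinP; apply: measurableT_comp => //.
    exact: measurable_funB.
  - apply: emeasurable_funD; last exact: emeasurable_sum.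
    by apply: emeasurable_funD => //; exact: emeasurable_funD.
  - move=> w' _; rewrite /bound; under eq_bigr do rewrite -EFinM.
    by rewrite sumEFin -!EFinD lee_fin; exact: dist_le_grid.
have Ibound : (\int[P]_w' bound w' = (2 * dlt)%:E +
    \int[P]_w' (tail n (G (eta w')))%:E + \int[P]_w' (tail n (G (Y w')))%:E +
    \sum_(j < 2 * n.+1 ^ 2) (dlt%:E * \int[P]_w' (sep j w')%:E))%E.
  rewrite ge0_integralD//; first last.
  - exact: emeasurable_sum.
  - by move=> w' _; exact: sume_ge0.
  - by apply: emeasurable_funD => //; exact: emeasurable_funD.
  - by move=> w' _; rewrite !adde_ge0.
  rewrite ge0_integralD//; first last.
  - exact: emeasurable_funD.
  - by move=> w' _; rewrite !adde_ge0.
  rewrite ge0_integralD//.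
  rewrite integral_cst//= probability_setT mule1; congr (_ + _)%E.
  rewrite ge0_integral_sum//; apply: eq_bigr => j _.
  by rewrite ge0_integralZl//; exact/measurable_EFinP.
rewrite Ibound mP (integral_sample eta_law (mtail n)) => [|y]; last exact: tail_ge0.
have sumsep : (\sum_(j < 2 * n.+1 ^ 2) (dlt%:E * \int[P]_w' (sep j w')%:E) <=
    (e / 4)%:E)%E.
  apply: (@le_trans _ _ (\sum_(j < 2 * n.+1 ^ 2) (dlt * e')%:E)%E).
    by apply: lee_sum => j _; rewrite EFinM lee_wpmul2l ?lee_fin.
  rewrite (sumEFin _ _ (fun=> dlt * e')) lee_fin sumr_const card_ord.
  rewrite -[X in X <= _]mulr_natl natrM natrX /e' /dlt.
  rewrite le_eqVlt; apply/orP; left; apply/eqP.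
  by field; exact: lt0r_neq0.
apply: (le_trans (leeD2l _ sumsep)); rewrite -!EFinD lee_fin.
have : (\sum_(i < N) tail n (G (X i w))) / N%:R <= 2 * (m n + e / 16).
  by rewrite ler_pdivrMr// mulrC.
rewrite -/dlt in nd *; move: nm nd e0.
set s1 := (\sum_(_ < N) _) / _; set x := dlt; lra.
Unshelve. all: by end_near. Qed.

End sample_convergence.

(** * The support functional on the Orlicz space *)

Section orlicz_duality.
Context d (T : measurableType d) (R : realType) (P : probability T R).
Variable phi : R -> R.
Hypothesis phi_young : young_density phi.

Local Notation Phi := (young_fun phi).
Local Notation Psi := (young_fun (conj_density phi)).

Let phi_nd := young_density_nonneg_nondecreasing phi_young.
Let psi_nd := conj_density_nonneg_nondecreasing phi_young.

Let measurable_young_comp f (k : R) (X : {RV P >-> R}) :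
  nonneg_nondecreasing f ->
  measurable_fun [set: T] (fun w => (young_fun f (X w * k))%:E).
Proof.
move=> ff; apply/measurable_EFinP.
apply: (measurableT_comp (measurable_young_fun ff)).
by apply: measurable_funM => //; exact: measurable_funPT.
Qed.

(** Young's inequality for the pair [h / l], [k * eta], integrated. *)
Lemma integral_mul_le (eta h : {RV P >-> R}) (k l : R) : 0 < k -> 0 < l ->
  (\int[P]_w `|eta w * h w|%:E <= (4 / k)%:E *
    (l%:E * \int[P]_w (Phi (h w / l))%:E + l%:E * \int[P]_w (Psi (k * eta w))%:E))%E.
Proof.
move=> k0 l0.
have mh := measurable_young_comp l^-1 h phi_nd.
have me : measurable_fun [set: T] (fun w => (Psi (k * eta w))%:E).
  by under eq_fun do rewrite mulrC; exact: measurable_young_comp.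
have Phi0 x : 0 <= Phi x by exact: young_fun_ge0.
have Psi0 x : 0 <= Psi x by exact: young_fun_ge0.
have k4 : 0 <= 4 / k by rewrite divr_ge0// ltW.
have Ih0 : (0 <= \int[P]_w (Phi (h w / l))%:E)%E.
  by apply: integral_ge0 => w _; rewrite lee_fin.
have Ie0 : (0 <= \int[P]_w (Psi (k * eta w))%:E)%E.
  by apply: integral_ge0 => w _; rewrite lee_fin.
have l0E : (0 <= l%:E)%E by rewrite lee_fin ltW.
rewrite -ge0_muleDr// -ge0_integralD//; first last.
- by move=> w _; rewrite lee_fin.
- by move=> w _; rewrite lee_fin.
have mhe : measurable_fun [set: T]
    (fun w => (Phi (h w / l))%:E + (Psi (k * eta w))%:E)%E.
  exact: emeasurable_funD.
have he0 w : (0 <= (Phi (h w / l))%:E + (Psi (k * eta w))%:E)%E.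
  by rewrite -EFinD lee_fin addr_ge0.
rewrite -ge0_integralZl// -ge0_integralZl//; first last.
- by move=> w _; rewrite mule_ge0.
- exact: measurable_funeM.
apply: ge0_le_integral => //.
- apply/measurable_EFinP; apply: measurableT_comp => //.
  by apply: measurable_funM; exact: measurable_funPT.
- by do 2 apply: measurable_funeM.
- move=> w _; rewrite -EFinD -!EFinM lee_fin normrM.
  have a0 : 0 <= `|h w| / (2 * l) by rewrite divr_ge0// mulr_ge0// ltW.
  have b0 : 0 <= k * `|eta w| / 2 by rewrite divr_ge0// mulr_ge0// ltW.
  have := weak_young_inequality phi_young a0 b0.
  have -> : 2 * (`|h w| / (2 * l)) = `|h w / l|.
    by rewrite normrM normfV (ger0_norm (ltW l0)); field; exact: lt0r_neq0.
  have -> : 2 * (k * `|eta w| / 2) = `|k * eta w|.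
    by rewrite normrM (ger0_norm (ltW k0)); field.
  rewrite !young_fun_norm => ineq.
  have -> : `|eta w| * `|h w| = 4 / k * (l * (`|h w| / (2 * l) * (k * `|eta w| / 2))).
    by field; rewrite !lt0r_neq0.
  by rewrite ler_wpM2l// ler_wpM2l// ltW.
Qed.

Variable S : set {RV P >-> R}.
Hypothesis S_nonempty : S !=set0.
Hypothesis S_lim : (ereal_sup
   [set l%:E * 'E_P[(fun w => Phi (h w / l))%R] | h in S]
   @[l --> +oo%R] --> 0)%E.

Local Notation rho := (sup_expectation S).

(** Uniform integrability of [S] against [L^Psi]: convergence in the modular of
    Psi implies convergence in mean against every element of [S], uniformly. *)
Lemma uniform_modular_continuity (k e : R) : 0 < k -> 0 < e ->
  exists2 c : R, 0 < c & forall eta : {RV P >-> R},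
    (\int[P]_w (Psi (k * eta w))%:E <= c%:E)%E ->
    forall h, S h -> (\int[P]_w `|eta w * h w|%:E <= e%:E)%E.
Proof.
(* With [l] fixed by the hypothesis on [S], each of the two terms of
   [integral_mul_le] is made at most [e / 2]. *)
move=> k0 e0; have e1 : 0 < e * k / 8 by rewrite divr_gt0// mulr_gt0.
have [l [l0 hl]] : exists l : R, 0 < l /\ forall h, S h ->
    (l%:E * \int[P]_w (Phi (h w / l))%:E <= (e * k / 8)%:E)%E.
  have /fine_cvgP[[M1 [_ h1]] /cvgrPdist_lt/(_ _ e1)[M2 [_ h2]]] := S_lim.
  pose l := Num.max 1 (Num.max (M1 + 1) (M2 + 1)).
  have M1l : M1 < l by rewrite !lt_max ltrDl ltr01 orbT.
  have M2l : M2 < l by rewrite !lt_max (ltrDl M2) ltr01 !orbT.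
  exists l; split; first by rewrite lt_max ltr01.
  move=> h Sh; have := h2 _ M2l; have /= fin := h1 _ M1l.
  rewrite sub0r normrN => /(le_lt_trans (ler_norm _)) supl.
  apply: (@le_trans _ _ (ereal_sup
      [set l%:E * 'E_P[(fun w => Phi (h w / l))%R] | h in S])%E).
    by apply: ereal_sup_ubound; exists h => //; rewrite unlock.
  by rewrite -(fineK fin) lee_fin ltW.
exists (e * k / 8 / l); first by rewrite divr_gt0.
move=> eta heta h Sh; apply: le_trans (integral_mul_le eta h k0 l0) _.
apply: (@le_trans _ _ ((4 / k)%:E * ((e * k / 8)%:E + l%:E * (e * k / 8 / l)%:E))%E).
  apply: lee_wpmul2l; first by rewrite lee_fin divr_ge0// ltW.
  apply: leeD; first exact: hl.
  by apply: lee_wpmul2l => //; rewrite lee_fin ltW.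
rewrite -(EFinM l) -EFinD -EFinM lee_fin le_eqVlt; apply/orP; left; apply/eqP.
by field; rewrite !lt0r_neq0.
Qed.

Lemma orlicz_mul_bounded (eta : {RV P >-> R}) : orlicz Psi eta ->
  exists c : R, forall h, S h -> (\int[P]_w `|eta w * h w|%:E <= c%:E)%E.
Proof.
move=> [k k0]; rewrite unlock => etaoo.
have Psi0 x : 0 <= Psi x by exact: young_fun_ge0.
have Ie0 : (0 <= \int[P]_w (Psi (k * eta w))%:E)%E.
  by apply: integral_ge0 => w _; rewrite lee_fin.
have efin : (\int[P]_w (Psi (k * eta w))%:E)%E \is a fin_num by rewrite ge0_fin_numE.
have /fine_cvgP[[M1 [_ h1]] _] := S_lim.
pose l := Num.max 1 (M1 + 1).
have M1l : M1 < l by rewrite lt_max ltrDl ltr01 orbT.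
have l0 : 0 < l by rewrite lt_max ltr01.
have /= fin := h1 _ M1l.
set s := ereal_sup _ in fin; set I := integral _ _ _ in efin.
exists (4 / k * (fine s + l * fine I)) => h Sh.
apply: le_trans (integral_mul_le eta h k0 l0) _.
rewrite (EFinM (4 / k)) EFinD (EFinM l) !fineK//; apply: lee_wpmul2l.
  by rewrite lee_fin divr_ge0// ltW.
apply: leeD => //; apply: ereal_sup_ubound; exists h => //; first by rewrite unlock.
Qed.

Lemma orlicz_mul_integrable (eta h : {RV P >-> R}) : orlicz Psi eta -> S h ->
  P.-integrable [set: T] (EFin \o (eta \* h)%R).
Proof.
move=> etaD Sh; have [c hc] := orlicz_mul_bounded etaD.
apply/integrableP; split.
  by apply/measurable_EFinP; apply: measurable_funM; exact: measurable_funPT.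
by rewrite (le_lt_trans (hc h Sh))// ltry.
Qed.

Lemma sup_expectation_fin_num (eta : {RV P >-> R}) : orlicz Psi eta ->
  rho eta \is a fin_num.
Proof.
move=> etaD; have [c hc] := orlicz_mul_bounded etaD.
have [h0 Sh0] := S_nonempty.
rewrite fin_numElt; apply/andP; split.
  apply: (@lt_le_trans _ _ 'E_P[(eta \* h0)%R]%E).
    have := integrable_fin_num measurableT (orlicz_mul_integrable etaD Sh0).
    by rewrite unlock fin_numElt => /andP[].
  by apply: ereal_sup_ubound; exists h0.
apply: (@le_lt_trans _ _ c%:E); last by rewrite ltry.
apply: ge_ereal_sup => _ [h Sh <-]; apply: le_trans (hc h Sh); rewrite unlock.
apply: le_trans (lee_abs _) _; apply: le_abse_integral => //.
by apply: measurable_int; exact: orlicz_mul_integrable etaD Sh.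
Qed.

Lemma sup_expectation_le (eta zeta : {RV P >-> R}) (e : R) :
  orlicz Psi eta -> orlicz Psi zeta ->
  (forall h, S h -> (\int[P]_w `|(eta w - zeta w) * h w|%:E <= e%:E)%E) ->
  (rho eta <= rho zeta + e%:E)%E.
Proof.
move=> etaD zetaD hle; apply: ge_ereal_sup => _ [h Sh <-].
have ih := orlicz_mul_integrable etaD Sh.
have iz := orlicz_mul_integrable zetaD Sh.
apply: (@le_trans _ _ ('E_P[(zeta \* h)%R] + e%:E)%E); last first.
  by rewrite leeD2r//; apply: ereal_sup_ubound; exists h.
rewrite -leeBlDl; last first.
  by rewrite unlock; exact: integrable_fin_num.
rewrite unlock -integralB_EFin//=; apply: le_trans (hle h Sh).
apply: le_trans (lee_abs _) _.
rewrite (_ : (fun w => `|_|%:E) = fun w => `|((eta w - zeta w) * h w)%:E|%E)//.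
under [in leRHS]eq_integral do rewrite mulrBl EFinB.
apply: le_abse_integral => //.
apply: emeasurable_funD; first exact: measurable_int ih.
apply/measurable_EFinP; apply: measurableT_comp => //.
by apply: measurable_funM; exact: measurable_funPT.
Qed.

End orlicz_duality.

(** * Convergence of the functional along the sample *)

Section signed_young.
Context {R : realType}.

(** The odd function that equals [young_fun f (k * x)] for [x >= 0]. When [f] is
    nonnegative and nondecreasing and [k] positive, it is nondecreasing, and its
    increments dominate [young_fun f] of [k / 2] times those of the argument. *)
Definition signed_young (f : R -> R) (k x : R) : R :=
  if 0 <= x then young_fun f (k * x) else - young_fun f (k * x).

Variables (f : R -> R) (k : R).
Hypothesis ff : nonneg_nondecreasing f.
Hypothesis k0 : 0 < k.

Let young_k_le x y : `|x| <= `|y| -> young_fun f (k * x) <= young_fun f (k * y).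
Proof.
by move=> xy; apply: young_fun_le => //; rewrite !normrM ler_wpM2l.
Qed.

Lemma normr_signed_young x : `|signed_young f k x| = young_fun f (k * x).
Proof.
by rewrite /signed_young; case: ifP => _; rewrite ?normrN ger0_norm ?young_fun_ge0.
Qed.

Lemma signed_young_nondecreasing : {homo signed_young f k : x y / x <= y}.
Proof.
move=> x y xy; rewrite /signed_young; case: (leP 0 x) => x0; case: (leP 0 y) => y0.
- by apply: young_k_le; rewrite !ger0_norm.
- by lra.
- by rewrite (@le_trans _ _ 0) ?oppr_le0 ?young_fun_ge0.
- by rewrite lerN2; apply: young_k_le; rewrite !ltr0_norm// lerN2.
Qed.

(** By superadditivity when [x] and [y] have the same sign, by monotonicity
    otherwise: then [`|x - y| / 2] is at most the larger of [`|x|] and [`|y|]. *)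
Lemma young_fun_sub_le x y :
  young_fun f (k / 2 * (x - y)) <= `|signed_young f k x - signed_young f k y|.
Proof.
wlog yx : x y / y <= x.
  move=> H; have [yx|/ltW xy] := leP y x; first exact: H.
  rewrite [leRHS]distrC -young_fun_norm normrM.
  by rewrite [in leLHS]distrC -normrM young_fun_norm; exact: H.
have yf0 z : 0 <= young_fun f z by exact: young_fun_ge0.
have d0 : 0 <= x - y by rewrite subr_ge0.
have xyk : young_fun f (k / 2 * (x - y)) <= young_fun f (k * (x - y)).
  apply: young_fun_le => //.
  rewrite (normrM (k / 2) (x - y)) (normrM k (x - y)) ler_wpM2r//.
  have k20 : 0 <= k / 2 by rewrite divr_ge0// ltW.
  by rewrite (ger0_norm k20) (ger0_norm (ltW k0)); move: k0; lra.
have kd0 : 0 <= k * (x - y) by rewrite mulr_ge0// ltW.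
rewrite ger0_norm ?subr_ge0 ?signed_young_nondecreasing// /signed_young.
case: (leP 0 x) => x0; case: (leP 0 y) => y0.
- apply: (le_trans xyk); have ky0 : 0 <= k * y by rewrite mulr_ge0// ltW.
  have := young_fun_superadditive ff ky0 kd0.
  by rewrite -mulrDr subrKC; lra.
- rewrite opprK.
  have half : `|2^-1 * (x - y)| = 2^-1 * (x - y) by rewrite ger0_norm// mulr_ge0.
  have [h|/ltW h] := leP (`|y|) (`|x|).
    apply: (@le_trans _ _ (young_fun f (k * x))); last by rewrite lerDl.
    rewrite -mulrA; apply: young_k_le; move: h.
    by rewrite half (ger0_norm x0) (ltr0_norm y0); lra.
  apply: (@le_trans _ _ (young_fun f (k * y))); last by rewrite lerDr.
  rewrite -mulrA; apply: young_k_le; move: h.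
  by rewrite half (ger0_norm x0) (ltr0_norm y0); lra.
- by lra.
- apply: (le_trans xyk); have kx0 : 0 <= k * - x by rewrite mulr_ge0 ?oppr_ge0// ltW.
  have := young_fun_superadditive ff kx0 kd0.
  rewrite -mulrDr (_ : - x + (x - y) = - y); last by ring.
  have even z : young_fun f (k * - z) = young_fun f (k * z).
    by rewrite mulrN -young_fun_norm normrN young_fun_norm.
  by rewrite !even; lra.
Qed.

End signed_young.

Section laws.
Context d (T : measurableType d) (R : realType) (P : probability T R).

(** A rearrangement invariant functional may be evaluated on laws at any element
    with the given law. *)
Lemma on_lawsE (D : set {RV P >-> R}) (r : {RV P >-> R} -> \bar R)
    (nu : set R -> \bar R) (X : {RV P >-> R}) :
  rearrangement_invariant D r -> D X -> has_law X nu -> on_laws D r nu = r X.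
Proof.
move=> ri DX Xnu; rewrite /on_laws.
have [DY Ynu] := @xgetPex _ (cst 0 : {mfun T >-> R})
  [set X | D X /\ has_law X nu] (ex_intro _ X (conj DX Xnu)).
by apply: ri => // A mA; rewrite Ynu// Xnu.
Qed.

Lemma bounded_orlicz (f : R -> R) (X : {RV P >-> R}) (M : R) :
  nonneg_nondecreasing f -> (forall w, `|X w| <= M) -> orlicz (young_fun f) X.
Proof.
move=> ff XM; exists 1 => //; rewrite unlock.
apply: (@le_lt_trans _ _ (\int[P]_w (young_fun f M)%:E)%E); last first.
  by rewrite integral_cst//= probability_setT mule1 ltry.
apply: ge0_le_integral => //.
- by move=> w _; rewrite lee_fin young_fun_ge0.
- apply/measurable_EFinP; apply: (measurableT_comp (measurable_young_fun ff)).
  by apply: measurable_funM => //; exact: measurable_funPT.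
- move=> w _; rewrite lee_fin mul1r; apply: young_fun_le => //.
  by rewrite (le_trans (XM w))// ler_norm.
Qed.

End laws.

Theorem theorem3 (R : realType) (d : measure_display) (T : measurableType d)
    (P : probability T R) (P_atomless : atomless P)
    (phi : R -> R) (phi_young : young_density phi)
    (S : set {RV P >-> R})
    (S_orlicz : S `<=` orlicz (young_fun phi))
    (S_density : S `<=` @prob_density _ _ _ P)
    (S_nonempty : S !=set0)
    (S_convex : convex_set (S : set (convex_lmodType {mfun T >-> R})))
    (S_closed : L1_closed S)
    (S_ri : rearrangement_invariant (orlicz (young_fun (conj_density phi)))
              (sup_expectation S))
    (S_lim : (ereal_sup
                [set l%:E * 'E_P[(fun w => young_fun phi (h w / l))%R] | h in S]
              @[l --> +oo%R] --> 0)%E)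
    (xi : {RV P >-> R}) (xi_orlicz : orlicz (young_fun (conj_density phi)) xi)
    (xi_ : nat -> {RV P >-> R})
    (xi_indep : mutually_independent xi_)
    (xi_law : forall n, same_law (xi_ n) xi) :
  let rho := on_laws (orlicz (young_fun (conj_density phi)))
               (sup_expectation S) in
  {ae P, forall w,
    rho (sample_distribution xi_ w N) @[N --> \oo] --> rho (distribution P xi)}.
Proof.
move=> rho; pose Psi := young_fun (conj_density phi).
have psi_nd := conj_density_nonneg_nondecreasing phi_young.
have [k k0] := xi_orlicz; rewrite unlock => xi_oo.
pose G := signed_young (conj_density phi) k.
have Gnd : {homo G : x y / x <= y} by exact: signed_young_nondecreasing.
have mG : measurable_fun [set: R] G by exact: nondecreasing_measurable.
have intG : (\int[P]_w `|G (xi w)|%:E < +oo)%E.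
  by under eq_integral do rewrite normr_signed_young//.
have pair := mutually_pairwise_independent xi_indep.
apply: filterS (ae_sample_coupling_cvg P_atomless xi_law pair Gnd intG) => w coupling.
have rho_xi : rho (distribution P xi) = sup_expectation S xi by exact: on_lawsE.
have fin := sup_expectation_fin_num phi_young S_nonempty S_lim.
have close e : 0 < e -> \forall N \near \oo,
    rho (sample_distribution xi_ w N) \is a fin_num /\
    `|fine (rho (distribution P xi)) - fine (rho (sample_distribution xi_ w N))| <= e.
  move=> e0; have k2 : 0 < k / 2 by rewrite divr_gt0.
  have [c c0 hc] := uniform_modular_continuity phi_young S_lim k2 e0.
  apply: filterS (coupling c c0) => N [eta [[M eta_bnd] eta_law eta_c]].
  have etaD : orlicz Psi eta by exact: bounded_orlicz eta_bnd.
  rewrite rho_xi /rho (on_lawsE S_ri etaD eta_law); split; first exact: fin.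
  have mG2 (U : {RV P >-> R}) : measurable_fun [set: T] (G \o U).
    by apply: measurableT_comp => //; exact: measurable_funPT.
  have mPsi2 (U V : {RV P >-> R}) :
      measurable_fun [set: T] (fun w' => (Psi (k / 2 * (U w' - V w')))%:E).
    apply/measurable_EFinP.
    apply: (measurableT_comp (measurable_young_fun psi_nd)).
    by apply: measurable_funM => //; apply: measurable_funB; exact: measurable_funPT.
  have small (U V : {RV P >-> R}) :
      (\int[P]_w' `|G (U w') - G (V w')|%:E <= c%:E)%E ->
      forall h, S h -> (\int[P]_w' `|(U w' - V w') * h w'|%:E <= e%:E)%E.
    move=> UVc h Sh.
    apply: (hc (U \- V : {mfun T >-> R}) _ h Sh); apply: le_trans UVc.
    apply: ge0_le_integral => //.
    - by move=> w' _; rewrite lee_fin young_fun_ge0.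
    - exact: (mPsi2 U V).
    - apply/measurable_EFinP; apply: measurableT_comp => //.
      exact: (measurable_funB (mG2 U) (mG2 V)).
    - by move=> w' _; rewrite lee_fin; exact: young_fun_sub_le.
  have le1 := sup_expectation_le phi_young S_lim etaD xi_orlicz (small _ _ eta_c).
  have le2 : (sup_expectation S xi <= sup_expectation S eta + e%:E)%E.
    apply: (sup_expectation_le phi_young S_lim xi_orlicz etaD); apply: small.
    by under eq_integral do rewrite distrC.
  move: le1 le2; rewrite -(fineK (fin _ xi_orlicz)) -(fineK (fin _ etaD)).
  rewrite -!EFinD !lee_fin/=.
  by rewrite ler_norml => h1 h2; apply/andP; split; lra.
have rfin : rho (distribution P xi) \is a fin_num by rewrite rho_xi; exact: fin.
rewrite -(fineK rfin); apply/fine_cvgP; split.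
  by apply: filterS (close _ ltr01) => N [].
by apply/cvgrPdist_le => e e0; apply: filterS (close _ e0) => N [].
Qed.
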